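(* Let $k\ge1$ and $n\ge1$. The descending strictly $k$-Naples parking functions of length $n$ are in bijection with the $(2k+2)$-in-$(n+k+1)$ dissections, taken up to rotation, together with a distinguished edge of the $(2k+2)$-gon.
   Context: An $r$-in-$s$ dissection is a dissection of a convex $s$-gon, by non-crossing diagonals, into one $r$-gon and $s-r$ triangles. Here one considers pairs consisting of a $(2k+2)$-in-$(n+k+1)$ dissection and a distinguished edge of its $(2k+2)$-gon, with two such pairs identified if one is obtained from the other by a rotation of the $(n+k+1)$-gon. Parking rules: $n$ spots $1,\dots,n$; cars $c_1,\dots,c_n$ arrive in order with preferences $a_j\in[n]$; $k$-Naples rule: $c_j$ parks at $a_j$ if empty, otherwise checks spots $a_j-1,\dots,a_j-k$ (those $\ge1$) in order and parks in the first empty one, otherwise drives forward from $a_j$ and parks in the first empty spot after $a_j$ (failing if none). A preference is $k$-Naples if all cars park ($0$-Naples = ordinary parking functions), and strictly $k$-Naples if it is $k$-Naples but not $(k-1)$-Naples. Descending means weakly decreasing. *)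

(* Defs.v *)
From mathcomp Require Import all_boot.

Set Implicit Arguments.
Unset Strict Implicit.
Unset Printing Implicit Defensive.

(* Spots and preferences are 0-based: spot p of {1, ..., n} is the number p - 1. *)

(* All spots examined by a car with preference a, in the order in which it
   examines them: a, then a - 1, ..., a - k as long as they exist, then the
   spots after a. *)
Definition naples_route (k n a : nat) : seq nat :=
  a :: [seq a - j | j <- iota 1 k & j <= a] ++ iota a.+1 (n - a.+1).

Fixpoint all_park (k n : nat) (occupied prefs : seq nat) : bool :=
  if prefs is a :: prefs' then
    if [seq p <- naples_route k n a | p \notin occupied] is p :: _
    then all_park k n (p :: occupied) prefs'
    else false
  else true.

Definition naples (k n : nat) (a : n.-tuple 'I_n) : bool :=
  all_park k n [::] [seq val i | i <- a].

(* For 0 < k; at k = 0 this is empty, since 0.-1 = 0. *)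
Definition strictly_naples (k n : nat) (a : n.-tuple 'I_n) : bool :=
  naples k a && ~~ naples k.-1 a.

Definition descending (n : nat) (a : n.-tuple 'I_n) : bool :=
  sorted geq [seq val i | i <- a].

Section Dissections.

(* The vertices of the convex s-gon, in cyclic order, are 0, ..., s - 1. *)
Variable s : nat.
Implicit Types (P d e : {set 'I_s}) (D : {set {set 'I_s}}).

(* A polygon inscribed in the s-gon is given by its set P of vertices; as enum P
   is increasing, next (enum P) x is the cyclic successor of x in P. *)
Definition polygon_edges P : {set {set 'I_s}} :=
  [set [set x; next (enum P) x] | x in P].

Definition diagonals : {set {set 'I_s}} :=
  [set d : {set 'I_s} | (#|d| == 2) && (d \notin polygon_edges [set: 'I_s])].

(* Not symmetric: d is the chord with the smallest endpoint; is_dissection tests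
   both orders. *)
Definition crossing d e : bool :=
  [exists a in d, exists b in d, exists x in e, exists y in e,
     [&& a < x, x < b & b < y]].

Definition is_dissection D : bool :=
  (D \subset diagonals) && [forall d in D, forall e in D, ~~ crossing d e].

(* The pieces cut out by D: inscribed polygons bounded by sides of the s-gon and
   diagonals in D, and not further divided by a diagonal in D.  Since D is
   non-crossing, a diagonal that divides P joins two vertices of P. *)
Definition pieces D : {set {set 'I_s}} :=
  [set P : {set 'I_s} |
     [&& 2 < #|P|,
         polygon_edges P \subset polygon_edges [set: 'I_s] :|: D
       & [forall d in D, (d \subset P) ==> (d \in polygon_edges P)]]].

(* One r-gon P and s - r triangles; #|P| = r forces r <= s. *)
Definition in_dissection (r : nat) D : bool :=
  is_dissection D &&
  [exists P in pieces D,
     [&& #|P| == r, #|pieces D :\ P| == s - r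
       & [forall Q in pieces D :\ P, #|Q| == 3]]].

Definition marked_dissections (r : nat) : {set {set {set 'I_s}} * {set 'I_s}} :=
  [set De | in_dissection r De.1 &&
            [exists P in pieces De.1, (#|P| == r) && (De.2 \in polygon_edges P)]].

Definition rotate (t : nat) (A : {set 'I_s}) : {set 'I_s} :=
  [set iter t (@ordS s) x | x in A].

Definition rotate_marked (t : nat) (De : {set {set 'I_s}} * {set 'I_s}) :=
  ([set rotate t d | d in De.1], rotate t De.2).

Definition rotation_equiv : rel ({set {set 'I_s}} * {set 'I_s}) :=
  [rel X Y | [exists t : 'I_s, Y == rotate_marked t X]].

Definition marked_dissection_classes (r : nat) :=
  equivalence_partition rotation_equiv (marked_dissections r).

Lemma val_iter_ordS t (x : 'I_s) : val (iter t (@ordS s) x) = (x + t) %% s.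
Proof.
elim: t => [|t IH] /=; first by rewrite addn0 modn_small.
by rewrite IH -addn1 modnDml addn1 addnS.
Qed.

Lemma rotate0 X : rotate_marked 0 X = X.
Proof.
by case: X => D e; rewrite /rotate_marked /rotate /= !imset_id;
   congr pair; rewrite (eq_imset (g := id)) ?imset_id // => d /=; rewrite imset_id.
Qed.

Lemma rotateD t u X :
  rotate_marked t (rotate_marked u X) = rotate_marked (t + u) X.
Proof.
have rotAD A : rotate t (rotate u A) = rotate (t + u) A.
  by rewrite /rotate -imset_comp; apply: eq_imset => x /=; rewrite iterD.
case: X => D e; rewrite /rotate_marked /= rotAD; congr pair.
by rewrite -imset_comp; apply: eq_imset => d /=; rewrite rotAD.
Qed.

Lemma rotate_mod t X : rotate_marked (t %% s) X = rotate_marked t X.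
Proof.
have rotA A : rotate (t %% s) A = rotate t A.
  by apply: eq_imset => x /=; apply: val_inj; rewrite !val_iter_ordS modnDmr.
by rewrite /rotate_marked rotA; congr pair; apply: eq_imset => d.
Qed.

Lemma rotation_equivP X Y : 0 < s ->
  reflect (exists t, Y = rotate_marked t X) (rotation_equiv X Y).
Proof.
move=> s_gt0; apply: (iffP existsP) => [[t /eqP->]|[t ->]]; first by exists t.
by exists (Ordinal (ltn_pmod t s_gt0)); rewrite /= rotate_mod.
Qed.

Lemma rotation_equiv_rel : 0 < s -> equivalence_rel rotation_equiv.
Proof.
move=> s_gt0; apply/equivalence_relP; split=> [X|X Y XY Z].
  by apply/rotation_equivP => //; exists 0; rewrite rotate0.
move/rotation_equivP: XY => /(_ s_gt0)[t ->].
apply/rotation_equivP/rotation_equivP => // -[u ->]; last first.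
  by exists (u + t); rewrite rotateD.
exists (u + (s * t - t)); rewrite rotateD -addnA subnK ?leq_pmull //.
by rewrite -[RHS]rotate_mod -modnDmr modnMr addn0 rotate_mod.
Qed.

End Dissections.

(* Main.v *)
Require Import Defs.
From mathcomp Require Import all_boot zify.

Set Implicit Arguments.
Unset Strict Implicit.
Unset Printing Implicit Defensive.

(* Both sides have C(2n-1, n+k) - C(2n-1, n+k+1) elements.

   A car that follows a weakly decreasing list of preferences only meets cars
   that preferred its spot a or a later one, so the taken spots below a form a
   block ending at a and contained in [a-k, a].  Hence the j-th car (from 0) is
   stuck exactly when a_j + j >= n + k, and the descending k-Naples functions
   are the lattice paths that stay on one side of a line.

   A class of marked dissections has exactly one representative in which the
   marked edge of the r-gon ends at vertex 0.  Cutting the s-gon at 0, with s a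
   second copy of 0, the r-gon becomes a chain 0 = p_0 < ... < p_r = s over
   whose links hang triangulations, that is, binary trees; the forests of r
   binary trees with m internal nodes satisfy the ballot recurrence
   F(r, m) = F(r-1, m) + F(r+1, m-1). *)

(** * Descending Naples parking functions *)

(** The bijection is extracted from an equality of cardinalities, through enumerations of the two
    finite types. On the parking side the count is a difference of two reflection counts, for [k]
    and for [k.-1], in which C(2n-1, n) cancels. On the other side s = n+k+1 and r = 2k+2 give m =
    s-r = n-k-1 internal nodes, so 2m+r-1 = 2n-1 and m+r = n+k+1, and the ballot number C(2m+r-1,
    m+r-1) - C(2m+r-1, m+r) is that same difference. The geometry is shaped by r = 2k+2 >= 4, in two
    ways. The r-gon is the only piece that is not a triangle, so the dissection determines it. And
    identifying s with 0 folds an arc (y, s) onto {0, y}, which might also come from (0, y) or be a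
    side; three corners [p1 < q < pl] strictly between 0 and s, over which no arc passes, rule out
    these coincidences. *)

Lemma geq_transitive : transitive geq.
Proof. by move=> x y z /= xy yz; apply: leq_trans yz xy. Qed.

Lemma gtn_transitive : transitive gtn.
Proof. by move=> x y z /= xy yz; apply: ltn_trans yz xy. Qed.

(* [size l] is the number of cars still to park: this is a_j + j < n + k. *)
Fixpoint bounded (k : nat) (l : seq nat) : bool :=
  if l is a :: l' then (a < size l + k) && bounded k l' else true.

Definition back_block (k : nat) (O : seq nat) (a : nat) : Prop :=
  forall p, p \in O -> p < a ->
    a <= p + k /\ (forall q, p <= q <= a -> q \in O).

Lemma mem_naples_route k n a p : a < n ->
  (p \in naples_route k n a) = (a - k <= p < n).
Proof.
move=> an; rewrite inE mem_cat mem_iota; apply/idP/idP.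
  case/or3P => [/eqP->|/mapP[j]|]; try lia.
  rewrite mem_filter mem_iota; lia.
move=> H; case: (ltngtP p a) => //= pa; last lia.
rewrite orbC; apply/orP; right; apply/mapP; exists (a - p); last lia.
rewrite mem_filter mem_iota; lia.
Qed.

(** Makes the first free spot met while backing up the largest free one, so that every spot between
    it and [a] is taken. *)
Lemma sorted_back k a :
  sorted gtn [seq a - j | j <- iota 1 k & j <= a].
Proof.
have: sorted ltn [seq j <- iota 1 k | j <= a].
  by apply: sorted_filter (iota_ltn_sorted _ _); apply: ltn_trans.
have: all (leq^~ a) [seq j <- iota 1 k | j <= a] by apply: filter_all.
elim: [seq j <- _ | _] => //= x [|y l] //= IH /and3P[xa ya al] /andP[xy pl].
rewrite IH ?ya //= andbT; lia.
Qed.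

(** A car that parks at [a] or further on adds nothing below [a]. A car that backs into p found [a]
    and all spots between p and [a] taken, and p is at most k below [a], so the block is merely
    extended down to p. *)
Lemma back_block_step k n O a p l : a < n -> back_block k O a ->
  [seq p <- naples_route k n a | p \notin O] = p :: l ->
  back_block k (p :: O) a.
Proof.
move=> an HO; rewrite /= => E q; rewrite inE => /orP[/eqP->{q}|qO] qa; last first.
  by have [H1 H2] := HO q qO qa; split=> // z /H2; rewrite inE => ->; rewrite orbT.
move: E; case: ifP => [_ [E]|/negbFE aO]; first by move: qa; rewrite E ltnn.
rewrite filter_cat; set B := [seq a - j | j <- _ & _].
case EB: [seq p <- B | p \notin O] => [|p' l'] /= E.
  have: p \in p :: l by rewrite mem_head.
  by rewrite -E mem_filter mem_iota; lia.
case: E EB => -> _ EB.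
have: p \in p :: l' by rewrite mem_head.
rewrite -EB mem_filter => /andP[pO pB].
have/mapP[j] := pB; rewrite mem_filter mem_iota => Hj Ej.
split=> [|q Hq]; first lia.
rewrite inE; case: eqP => //= qp.
have [->//|qna] := eqVneq q a.
apply/negPn/negP => qO.
have: q \in p :: l'.
  rewrite -EB mem_filter qO; apply/mapP; exists (a - q); last lia.
  rewrite mem_filter mem_iota; lia.
have: sorted gtn (p :: l').
  by rewrite -EB; apply: sorted_filter (sorted_back _ _); apply: gtn_transitive.
rewrite /= (path_sortedE gtn_transitive) => /andP[/allP Hl _].
rewrite inE => /orP[/eqP//|/Hl] /=; lia.
Qed.

Lemma back_block_le k O a b : b <= a -> back_block k O a -> back_block k O b.
Proof.
move=> ba H p pO pb; have [H1 H2] := H p pO (leq_trans pb ba).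
split=> [|q Hq]; first lia.
apply: H2; lia.
Qed.

(* A car whose whole route is taken sees at least [n - (a - k)] cars; conversely
   the cars below [a] all sit in [a - k, a], so they cannot outnumber the route. *)
Lemma route_fullE k n (O : seq nat) a : a < n -> uniq O -> all (gtn n) O -> size O < n ->
  back_block k O a ->
  ([seq p <- naples_route k n a | p \notin O] == [::]) = (n + k <= a + size O).
Proof.
move=> an uO /allP On On' HO; rewrite -[_ == _]negbK -has_filter.
set I := iota (a - k) (n - (a - k)).
have memI p : (p \in I) = (a - k <= p < n) by rewrite mem_iota; lia.
have sI : size I = n - (a - k) by rewrite size_iota.
apply/hasPn/idP => [H|H p].
  have sub : {subset I <= O}.
    move=> p; rewrite memI => Hp; apply/negPn/H; by rewrite mem_naples_route.
  have : size I <= size O by apply: uniq_leq_size sub; apply: iota_uniq.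
  rewrite sI.
  lia.
rewrite mem_naples_route // => Hp; rewrite negbK.
have sub : {subset O <= I}.
  move=> q qO; have qn : q < n := On q qO; rewrite memI.
  case: (ltnP q a) => [qa|]; [have [H1 _] := HO q qO qa|]; lia.
have sz : size I <= size O by rewrite sI; lia.
have [_ ->] := uniq_min_size uO sub sz.
by rewrite memI.
Qed.

(** The invariant is asked for all remaining preferences at once: after a car with preference [a] it
    holds at [a], and [back_block_le] hands it down to the later preferences, which are at most [a].
    Since [size O + size l = n], the threshold of [route_fullE] becomes the inequality of
    [bounded]. *)
Lemma all_parkE k n (l O : seq nat) : sorted geq l -> all (gtn n) l -> uniq O ->
  all (gtn n) O -> (forall a, a \in l -> back_block k O a) ->
  size O + size l = n -> all_park k n O l = bounded k l.
Proof.
elim: l O => // a l IH O pal /andP[an ln] uO On HO sO.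
have Ha : back_block k O a by apply: HO; rewrite mem_head.
rewrite /= in sO; have sOn : size O < n by lia.
have := route_fullE an uO On sOn Ha.
have -> : all_park k n O (a :: l) =
  if [seq p <- naples_route k n a | p \notin O] is p :: _
  then all_park k n (p :: O) l else false by [].
case E: [seq p <- naples_route k n a | p \notin O] => [|p l'].
  by rewrite eqxx /= => /esym H; apply/esym/negbTE; rewrite negb_and; apply/orP; left; lia.
move=> /esym/negbT H; rewrite /=; have -> /= : a < (size l).+1 + k by lia.
have : p \in p :: l' by rewrite mem_head.
rewrite -E mem_filter mem_naples_route // => /andP[pO Hp].
rewrite IH //=; last lia.
- exact: path_sorted pal.
- by rewrite pO.
- by rewrite On andbT; lia.
- move=> b bl; apply: (@back_block_le _ _ a); last exact: (back_block_step an Ha E).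
  by move: pal; rewrite /= (path_sortedE geq_transitive) => /andP[/allP/(_ b bl)].
Qed.

Lemma naplesE k n (a : n.-tuple 'I_n) : descending a ->
  naples k a = bounded k [seq val i | i <- a].
Proof.
move=> da; apply: all_parkE => //=; last by rewrite size_map size_tuple.
by apply/allP => _ /mapP[i _ ->] /=.
Qed.

Lemma bounded_le k k' l : k <= k' -> bounded k l -> bounded k' l.
Proof. by move=> kk; elim: l => //= a l IH /andP[al /IH->]; lia. Qed.

(** Reflection count: C(i+v-1, i) weakly decreasing sequences in all, minus the C(i+v-1, i+k+1) that
    break the bound. The recurrence asks whether the head is the largest allowed value. The range of
    v reaches one step past the line, to the value where the boundary condition is read off. *)
Lemma ex_bounded_seqs k i v : v <= i + k + 1 ->
  exists L : seq (seq nat), [/\ uniq L,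
    forall l : seq nat, (l \in L) =
      [&& size l == i, sorted geq l, all (gtn v) l & bounded k l] &
    size L + 'C((i + v).-1, i + k + 1) = 'C((i + v).-1, i)].
Proof.
elim: i v => [|i IHi] v.
  move=> Hv; exists [:: [::]]; split=> //= [[|x l]//|].
  by rewrite bin0 bin_small //; lia.
elim: v => [|v IHv] Hv.
  exists [::]; split=> //= [[|x l]//=|]; first by rewrite !andbF.
  by rewrite !bin_small //; lia.
have [|L2 [uL2 mL2 sL2]] := IHv _; first lia.
have mem_step (l : seq nat) : [&& size l == i.+1, sorted geq l, all (gtn v.+1) l & bounded k l] =
  [&& size l == i.+1, sorted geq l, all (gtn v) l & bounded k l] ||
  [&& size l == i.+1, head 0 l == v, sorted geq l, all (gtn v.+1) l & bounded k l].
  case: l => //= x l.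
  rewrite !(path_sortedE geq_transitive) eqSS; case: (size l == i) => //=.
  case Hs: (sorted geq l); rewrite ?andbF //= ?andbT.
  case Ha: (all (geq x) l) => //=; rewrite ?andbF //=.
  case Hb: (bounded k l); rewrite ?andbF //= ?andbT.
  have Hx w : x < w -> all (gtn w) l.
    by move=> xw; apply/allP => y /(allP Ha) /=; lia.
  case: (ltngtP x v) => xv.
  - by rewrite (Hx v) // (Hx v.+1) ?ltnS ?(ltnW xv) //= ?andbF ?orbF.
  - by rewrite ltnS leqNgt xv /= ?andbF.
  - by rewrite xv ltnSn /= ?andbF.
(* At v = i+1+k a head equal to v breaks the bound, so nothing is added to [L2]. On the binomial
   side the two increments agree by symmetry, as (i+k+1) + i is the upper index. *)
have [vi|vi] := leqP v (i + k); last first.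
  have Ev : v = i.+1 + k by lia.
  exists L2; split=> //.
    move=> l; rewrite mem_step -mL2; apply/esym/orb_idr.
    case: l => //= x l /and5P[/eqP[->] /eqP-> _ _ /andP[+ _]]; lia.
  have Eb : 'C((i.+1 + v).-1, (i + k).+1) = 'C((i.+1 + v).-1, i).
    have -> : (i + k).+1 = (i.+1 + v).-1 - i by lia.
    by rewrite bin_sub //; lia.
  have E2 : (i.+1 + v.+1).-1 = (i.+1 + v).-1.+1 by lia.
  have E3 : i.+1 + k + 1 = (i + k).+2 by lia.
  by move: sL2; rewrite E2 E3 !binS Eb; lia.
have [|L1 [uL1 mL1 sL1]] := IHi v.+1 _; first lia.
exists ([seq v :: l | l <- L1] ++ L2); split.
- rewrite cat_uniq uL2 andbT map_inj_uniq ?uL1 /= => [|x y []//].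
  apply/hasPn => l; rewrite mL2 => /and4P[_ _ al _]; apply/negP => /mapP[l' _ E].
  by move: al; rewrite E /= ltnn.
- move=> l; rewrite mem_step -mL2 mem_cat orbC; congr (_ || _).
  apply/mapP/idP => [[l'] + ->|].
    rewrite mL1 => /and4P[/eqP si sl al bl] /=; rewrite si !eqxx bl al ltnSn /=.
    have -> /= : v < i.+1 + k by lia.
    rewrite (path_sortedE geq_transitive) sl !andbT.
    by apply: sub_all al => y /=.
  case: l => //= x l /and5P[/eqP[sl] /eqP-> pl /andP[_ al] /andP[_ bl]].
  exists l => //; rewrite mL1 sl eqxx al bl (path_sorted pl) //.
- rewrite size_cat size_map.
  have E1 : (i + v.+1).-1 = i + v by lia.
  have E2 : (i.+1 + v).-1 = i + v by lia.
  have E3 : (i.+1 + v.+1).-1 = (i + v).+1 by lia.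
  move: sL1 sL2; rewrite E1 E2 E3.
  have -> : i.+1 + k + 1 = (i + k + 1).+1 by lia.
  rewrite !binS; lia.
Qed.

Lemma card_descending_naples k n : 0 < n ->
  #|[pred a : n.-tuple 'I_n | descending a && naples k a]|
    + 'C((n + n).-1, n + k + 1) = 'C((n + n).-1, n).
Proof.
move=> n0; have [|L [uL mL <-]] := @ex_bounded_seqs k n n; first lia.
congr (_ + _); rewrite cardE.
rewrite -(size_map (fun a : n.-tuple 'I_n => [seq val i | i <- a])).
apply/perm_size/uniq_perm => //.
  rewrite map_inj_uniq ?enum_uniq // => a b /(inj_map val_inj) E.
  exact: val_inj.
move=> l; rewrite mL; apply/mapP/and4P => [[a] + ->|[/eqP sl srt al bl]].
  rewrite mem_enum inE => /andP[da na]; split=> //.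
  - by rewrite size_map size_tuple.
  - by apply/allP => _ /mapP[i _ ->] /=.
  - by rewrite -naplesE.
case: n n0 sl mL al => // n _ sl _ al.
have st : size [seq (inord x : 'I_n.+1) | x <- l] == n.+1 by rewrite size_map sl.
have El : [seq val i | i <- [seq (inord x : 'I_n.+1) | x <- l]] = l.
  rewrite -map_comp map_id_in // => x xl /=.
  by rewrite inordK //; apply: (allP al).
exists (Tuple st) => //=.
have dt : descending (Tuple st) by rewrite /descending /= El.
by rewrite mem_enum inE dt naplesE //= El.
Qed.

(** By [bounded_le], descending (k-1)-Naples preferences are among the k-Naples ones, so the strict
    count is a plain difference. *)
Lemma card_descending_strictly_naples k n : 0 < k -> 0 < n ->
  #|[pred a : n.-tuple 'I_n | descending a && strictly_naples k a]|
    = 'C((n + n).-1, n + k) - 'C((n + n).-1, n + k + 1).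
Proof.
move=> k0 n0.
have H1 := card_descending_naples k n0.
have := card_descending_naples k.-1 n0.
have -> : n + k.-1 + 1 = n + k by lia.
set A := [pred a : n.-tuple 'I_n | _ && naples k a] in H1 *.
set B := [pred a : n.-tuple 'I_n | _ && naples k.-1 a] => H2.
have : #|[predI A & B]| + #|[predD A & B]| = #|A| := cardID B A.
have -> : #|[predI A & B]| = #|B|.
  apply: eq_card => a; rewrite !inE; case da: (descending a) => //=.
  rewrite !naplesE //; apply: andb_idl; apply: bounded_le; lia.
have -> : #|[predD A & B]| = #|[pred a : n.-tuple 'I_n | descending a && strictly_naples k a]|.
  by apply: eq_card => a; rewrite !inE /strictly_naples; case: (descending a) => //=; rewrite andbC.
lia.
Qed.

(** * Rotations of marked dissections *)

Section Polygons.

Variable s : nat.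
Implicit Types (P Q d e : {set 'I_s}) (D : {set {set 'I_s}}) (x y z : 'I_s).

(** The cyclic successor expressed by inequalities, for use in linear arithmetic. The second
    disjunct is the wrap-around from the largest element to the smallest; it allows x = y for a
    singleton. *)
Definition follows P x y : Prop :=
  (x < y /\ forall z, z \in P -> z <= x \/ y <= z) \/
  (y <= x /\ forall z, z \in P -> y <= z <= x).

Lemma sorted_enum_set P : sorted (relpre val ltn) (enum P).
Proof.
rewrite /enum_mem -enumT; apply: sorted_filter.
  by move=> x y z /=; apply: ltn_trans.
by rewrite -sorted_map val_enum_ord iota_ltn_sorted.
Qed.

Lemma follows_next P x : x \in P ->
  next (enum P) x \in P /\ follows P x (next (enum P) x).
Proof.
move=> xP; split; first by rewrite -mem_enum mem_next mem_enum.
have := sorted_enum_set P; have : x \in enum P by rewrite mem_enum.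
have : forall z, z \in P -> z \in enum P by move=> z; rewrite mem_enum.
rewrite next_nth => + xp; rewrite xp; case: (enum P) xp => // y0 p' xp mP srt.
set p := y0 :: p' in xp mP srt *; set i := index x p.
have tr : transitive (relpre val ltn : rel 'I_s) by move=> u v w /=; apply: ltn_trans.
have lt_nth := sorted_ltn_nth tr y0 srt.
have ip : i < size p by rewrite index_mem.
have Ex : x = nth y0 p i by rewrite nth_index.
have le_nth a b : a <= b < size p -> nth y0 p a <= nth y0 p b.
  case/andP; rewrite leq_eqVlt => /orP[/eqP->//|ab bp]; apply: ltnW.
  by apply: lt_nth => //; rewrite inE ?(ltn_trans ab).
have idx z : z \in P -> exists2 j, j < size p & z = nth y0 p j.
  by move=> /mP zp; exists (index z p); rewrite ?index_mem ?nth_index.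
have sp : size p = (size p').+1 by [].
have [ip'|ip'] := ltnP i (size p').
  left; have -> : nth y0 p' i = nth y0 p i.+1 by [].
  split; first by rewrite {1}Ex; apply: lt_nth; rewrite ?inE ?sp ?ltnS //; lia.
  move=> z /idx[j jp ->]; rewrite {1}Ex; case: (leqP j i) => ji; [left|right];
    apply: le_nth; lia.
(* Past the end of the tail, [nth] returns its default [y0], the smallest element of P: this is the
   wrap-around. *)
right; rewrite (nth_default _ ip').
have y0le z : z \in P -> y0 <= z by move=> /idx[j jp ->]; apply: (@le_nth 0); lia.
split; first exact: y0le.
move=> z zP; rewrite y0le //=.
by have [j jp ->] := idx z zP; rewrite {1}Ex; apply: le_nth; lia.
Qed.

Lemma next_eq P x y : x \in P -> y \in P -> follows P x y -> next (enum P) x = y.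
Proof.
move=> xP yP H; have [] := follows_next xP; move: (next _ _) => y' yP' H'.
apply: val_inj => /=.
case: H => [] [H1 H2]; case: H' => [] [H3 H4].
- have := H2 _ yP'; have := H4 _ yP; lia.
- have := H4 _ yP; lia.
- have := H2 _ yP'; lia.
- have := H2 _ yP'; have := H4 _ yP; lia.
Qed.

Lemma set2_inj x y u v : [set x; y] = [set u; v] ->
  (x = u /\ y = v) \/ (x = v /\ y = u).
Proof.
move=> E.
have : x \in [set u; v] by rewrite -E set21.
have : y \in [set u; v] by rewrite -E set22.
have : u \in [set x; y] by rewrite E set21.
have : v \in [set x; y] by rewrite E set22.
rewrite !inE.
by do 4![case/orP => /eqP ?]; subst; auto.
Qed.

(** The second alternative is the wrap-around edge, joining the largest vertex of P to the
    smallest. *)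
Lemma polygon_edgesP P x y : x < y ->
  reflect (x \in P /\ y \in P /\ ((forall z, z \in P -> z <= x \/ y <= z) \/
                                  (forall z, z \in P -> x <= z <= y)))
          ([set x; y] \in polygon_edges P).
Proof.
move=> xy; apply: (iffP imsetP) => [[u uP E]|[xP [yP H]]].
  have [vP Hv] := follows_next uP.
  by case: (set2_inj E) => [] [Ex Ey]; subst x y; split=> //; split=> //;
    case: Hv => [] [H1 H2]; auto; lia.
case: H => H.
  by exists x => //; rewrite (next_eq xP yP) //; left.
exists y => //; rewrite (next_eq yP xP) ?(setUC [set x]) //.
by right; split; [exact: ltnW|].
Qed.

Lemma polygon_edge_pair P e : 1 < #|P| -> e \in polygon_edges P ->
  exists x y, [/\ x < y, e = [set x; y], x \in P & y \in P].
Proof.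
move=> P2 /imsetP[u uP ->]; have [vP Hv] := follows_next uP.
set v := next _ _ in vP Hv *.
case: (ltngtP u v) => uv.
- by exists u, v.
- by exists v, u; rewrite setUC.
case: Hv => [] [H1 H2]; first lia.
suff /subset_leq_card : P \subset [set u] by rewrite cards1; lia.
apply/subsetP => z /H2; rewrite inE => H; apply/eqP/val_inj => /=; lia.
Qed.

Lemma rotateS t P : rotate t.+1 P = [set ordS x | x in rotate t P].
Proof. by rewrite /rotate -imset_comp; apply: eq_imset. Qed.

Lemma val_ordS x : val (ordS x) = if x.+1 == s then 0 else x.+1.
Proof.
have xs := ltn_ord x.
by rewrite /=; case: eqP => [->|/eqP ne]; rewrite ?modnn // modn_small //; lia.
Qed.

(** A single step suffices, larger rotations being iterates. Order is broken only at the last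
    vertex, sent to 0, so the cases depend on whether x or its successor is that vertex. *)
Lemma next_ordS P x : x \in P ->
  next (enum [set ordS x | x in P]) (ordS x) = ordS (next (enum P) x).
Proof.
move=> xP; have [yP H] := follows_next xP; set y := next _ x in yP H *.
apply: next_eq; rewrite ?imset_f //.
have ltx := ltn_ord x; have lty := ltn_ord y.
have imH (R : 'I_s -> Prop) : (forall z, z \in P -> R (ordS z)) ->
    forall z, z \in [set ordS x | x in P] -> R z.
  by move=> H' _ /imsetP[z zP ->]; apply: H'.
rewrite /follows; case: H => [] [xy H].
  have [Ey|ney] := eqVneq y.+1 s.
    right; split; first by move: (val_ordS x) (val_ordS y) => /= -> ->; do 2![case: eqP]; lia.
    apply: imH => z zP; have ltz := ltn_ord z.
    move: (val_ordS x) (val_ordS y) (val_ordS z) (H z zP) => /= -> -> ->.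
    by do 3![case: eqP]; lia.
  left; split; first by move: (val_ordS x) (val_ordS y) => /= -> ->; do 2![case: eqP]; lia.
  apply: imH => z zP; have ltz := ltn_ord z.
  move: (val_ordS x) (val_ordS y) (val_ordS z) (H z zP) => /= -> -> ->.
  by do 3![case: eqP]; lia.
have [Ex|nex] := eqVneq x.+1 s; last first.
  right; split; first by move: (val_ordS x) (val_ordS y) => /= -> ->; do 2![case: eqP]; lia.
  apply: imH => z zP; have ltz := ltn_ord z.
  move: (val_ordS x) (val_ordS y) (val_ordS z) (H z zP) => /= -> -> ->.
  by do 3![case: eqP]; lia.
have [Ey|ney] := eqVneq y.+1 s; [right|left];
  (split; first by move: (val_ordS x) (val_ordS y) => /= -> ->; do 2![case: eqP]; lia);
  apply: imH => z zP; have ltz := ltn_ord z;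
  move: (val_ordS x) (val_ordS y) (val_ordS z) (H z zP) => /= -> -> ->;
  by do 3![case: eqP]; lia.
Qed.

Lemma next_rotate t P x : x \in P ->
  next (enum (rotate t P)) (iter t (@ordS s) x) = iter t (@ordS s) (next (enum P) x).
Proof.
move=> xP; elim: t => [|t IH]; first by rewrite /rotate imset_id.
by rewrite rotateS /= next_ordS ?IH // imset_f.
Qed.

Lemma iter_ordS_inj t : injective (iter t (@ordS s)).
Proof. by elim: t => //= t IH x y /ordS_inj/IH. Qed.

Lemma rotate_inj t : injective (@rotate s t).
Proof. exact: imset_inj (@iter_ordS_inj t). Qed.

Lemma card_rotate t P : #|rotate t P| = #|P|.
Proof. exact: card_imset (@iter_ordS_inj t). Qed.

Lemma rotate_set2 t x y :
  rotate t [set x; y] = [set iter t (@ordS s) x; iter t (@ordS s) y].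
Proof. by rewrite /rotate imsetU1 imset_set1. Qed.

Lemma mem_rotate t P x : (iter t (@ordS s) x \in rotate t P) = (x \in P).
Proof. exact: mem_imset (@iter_ordS_inj t). Qed.

Lemma rotate_setT t : rotate t [set: 'I_s] = [set: 'I_s].
Proof. by apply/eqP; rewrite eqEcard subsetT card_rotate leqnn. Qed.

Lemma polygon_edges_rotate t P :
  polygon_edges (rotate t P) = [set rotate t e | e in polygon_edges P].
Proof.
apply/setP => e; apply/imsetP/imsetP => [[_ /imsetP[x xP ->] ->]|[_ /imsetP[x xP ->] ->]].
  exists [set x; next (enum P) x]; first exact: imset_f.
  by rewrite rotate_set2 next_rotate.
by exists (iter t (@ordS s) x); rewrite ?mem_rotate // rotate_set2 next_rotate.
Qed.

Lemma mem_pieces_rotate t D P :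
  (rotate t P \in pieces [set rotate t d | d in D]) = (P \in pieces D).
Proof.
have rI := @rotate_inj t.
rewrite !inE card_rotate; congr [&& _, _ & _].
  rewrite polygon_edges_rotate -{1}(rotate_setT t) polygon_edges_rotate -imsetU.
  apply/idP/idP => [|/imsetS->//] /subsetP H; apply/subsetP => e eP.
  by rewrite -(mem_imset _ _ rI) H ?imset_f.
rewrite polygon_edges_rotate; apply/forall_inP/forall_inP => [H d dD|H _ /imsetP[d dD ->]].
  have := H _ (imset_f (rotate t) dD); rewrite mem_imset //.
  apply: contraTT; rewrite !negb_imply => /andP[/(imsetS (iter t (@ordS s))) -> ].
  by move=> ->.
have := H _ dD; rewrite mem_imset //; apply: contraTT; rewrite !negb_imply.
move=> /andP[/subsetP dP ->]; rewrite andbT; apply/subsetP => x xd.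
by rewrite -(mem_rotate t) dP ?mem_rotate.
Qed.

Lemma pieces_rotate t D :
  pieces [set rotate t d | d in D] = [set rotate t P | P in pieces D].
Proof.
apply/setP => Q; rewrite -(f_invF (@rotate_inj t) Q).
by rewrite mem_pieces_rotate mem_imset //; apply: rotate_inj.
Qed.

(** [crossing] singles out the chord with the smallest endpoint, and a rotation may change which
    chord that is. The induction on t therefore runs on the symmetrized relation. *)
Lemma crossing_rotate t d e :
  crossing (rotate t d) (rotate t e) -> crossing d e || crossing e d.
Proof.
suff: crossing (rotate t d) (rotate t e) || crossing (rotate t e) (rotate t d) ->
      crossing d e || crossing e d by move=> H E; apply: H; rewrite E.
elim: t => [|t IH]; first by rewrite /rotate !imset_id.
suff one (d' e' : {set 'I_s}) : crossing [set ordS x | x in d'] [set ordS x | x in e'] ->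
    crossing d' e' || crossing e' d'.
  by rewrite !rotateS => /orP[] /one H; apply: IH; rewrite // orbC.
case/exists_inP => _ /imsetP[a ad ->] /exists_inP[_ /imsetP[b bd ->]].
case/exists_inP => _ /imsetP[x xe ->] /exists_inP[_ /imsetP[y ye ->]].
move: (val_ordS a) (val_ordS b) (val_ordS x) (val_ordS y) => /= -> -> -> ->.
have := ltn_ord a; have := ltn_ord b; have := ltn_ord x; have := ltn_ord y.
(* Having the smallest image, [a] alone can be the last vertex; it then lies beyond the other three
   endpoints and the chords exchange roles. *)
case: (a.+1 =P s) => Ea lty ltx ltb lta H; apply/orP; [right|left].
  apply/exists_inP; exists x => //; apply/exists_inP; exists y => //.
  apply/exists_inP; exists b => //; apply/exists_inP; exists a => //.
  by move: H; do 3![case: eqP]; lia.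
apply/exists_inP; exists a => //; apply/exists_inP; exists b => //.
apply/exists_inP; exists x => //; apply/exists_inP; exists y => //.
by move: H; do 3![case: eqP]; lia.
Qed.

Lemma is_dissection_rotate t D :
  is_dissection D -> is_dissection [set rotate t d | d in D].
Proof.
case/andP => /subsetP dD /forall_inP nD; apply/andP; split.
  apply/subsetP => _ /imsetP[d /dD + ->]; rewrite !inE card_rotate => /andP[-> /=].
  by rewrite -{2}(rotate_setT t) polygon_edges_rotate mem_imset //; apply: rotate_inj.
apply/forall_inP => _ /imsetP[d dd ->]; apply/forall_inP => _ /imsetP[e ed ->].
apply/negP => /crossing_rotate /orP[]; apply/negP.
  by have /forall_inP := nD d dd; apply.
by have /forall_inP := nD e ed; apply.
Qed.

Lemma in_dissection_rotate r t D :
  in_dissection r D -> in_dissection r [set rotate t d | d in D].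
Proof.
case/andP => /(is_dissection_rotate t) dD /exists_inP[P PD /and3P[cP cD tD]].
rewrite /in_dissection dD; apply/exists_inP; exists (rotate t P).
  by rewrite mem_pieces_rotate.
have -> : pieces [set rotate t d | d in D] :\ rotate t P =
          [set rotate t Q | Q in pieces D :\ P].
  rewrite pieces_rotate; apply/setP => Q.
  rewrite -(f_invF (@rotate_inj t) Q) !inE !mem_imset; try exact: rotate_inj.
  by rewrite !inE (inj_eq (@rotate_inj t)).
rewrite card_rotate cP card_imset ?cD /=; last exact: rotate_inj.
by apply/forall_inP => _ /imsetP[Q QD ->]; rewrite card_rotate (forall_inP tD).
Qed.

Lemma marked_rotate r t X :
  X \in marked_dissections s r -> rotate_marked t X \in marked_dissections s r.
Proof.
case: X => D e; rewrite !inE /= => /andP[/(in_dissection_rotate t)-> /=].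
case/exists_inP => P PD /andP[cP eP]; apply/exists_inP; exists (rotate t P).
  by rewrite mem_pieces_rotate.
by rewrite card_rotate cP polygon_edges_rotate imset_f.
Qed.

(** All pieces but one are triangles, so the piece with r vertices is recognized by its size; for r
    = 3 it could not be told apart. *)
Lemma big_piece_uniq r D P Q : r != 3 -> in_dissection r D ->
  P \in pieces D -> Q \in pieces D -> #|P| = r -> #|Q| = r -> P = Q.
Proof.
move=> r3 /andP[_ /exists_inP[M MD /and3P[_ _ /forall_inP H]]] PD QD cP cQ.
have E A : A \in pieces D -> #|A| = r -> A = M.
  move=> AD cA; apply/eqP/negPn/negP => AM; have := H A.
  by rewrite !inE in AD *; rewrite AM AD cA (negbTE r3) => /(_ isT).
by rewrite (E P) // (E Q).
Qed.

End Polygons.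

(** * A transversal of the rotation classes *)

Section Classes.

Variables (p r : nat).
Local Notation s := p.+1.
Hypothesis r3 : 3 < r.

Definition rooted_dissections : {set {set {set 'I_s}}} :=
  [set D | in_dissection r D &&
           [exists P in pieces D, (#|P| == r) && (ord0 \in P)]].

Definition rooted_marked : {set {set {set 'I_s}} * {set 'I_s}} :=
  [set X in marked_dissections s r |
     [exists P in pieces X.1, (#|P| == r) &&
        [exists x in P, (next (enum P) x == ord0) && (X.2 == [set x; ord0])]]].

Let rn3 : r != 3. Proof. by rewrite neq_ltn r3 orbT. Qed.

Lemma rooted_markedP X : reflect
  (exists P x, [/\ X \in marked_dissections s r, P \in pieces X.1, #|P| = r,
                   x \in P & next (enum P) x = ord0 /\ X.2 = [set x; ord0]])
  (X \in rooted_marked).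
Proof.
rewrite [X \in rooted_marked]in_set; apply: (iffP andP) => [[XM]|[P [x [XM PX cP xP [nx eX]]]]].
  case/exists_inP => P PX /andP[/eqP cP /exists_inP[x xP /andP[/eqP nx /eqP eX]]].
  by exists P, x.
split=> //; apply/exists_inP; exists P; rewrite // cP eqxx.
by apply/exists_inP; exists x; rewrite // nx eX !eqxx.
Qed.

(** The mark carries no further information: D determines its r-gon, and vertex 0 has a single
    predecessor on it. *)
Lemma card_rooted_marked : #|rooted_marked| = #|rooted_dissections|.
Proof.
rewrite -(card_in_imset (f := fst) (D := rooted_marked)).
  congr #|pred_of_set _|; apply/setP => D; apply/imsetP/idP.
    case=> X /rooted_markedP[P [x [XM PX cP xP [nx eX]]]] ->.
    move: XM; rewrite !inE => /andP[-> _]; apply/exists_inP; exists P => //.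
    by rewrite cP eqxx -nx -mem_enum mem_next mem_enum.
  rewrite inE => /andP[DD /exists_inP[P PD /andP[/eqP cP P0]]].
  exists (D, [set prev (enum P) ord0; ord0]) => //.
  have nx : next (enum P) (prev (enum P) ord0) = ord0 by rewrite next_prev ?enum_uniq.
  have xP : prev (enum P) ord0 \in P by rewrite -mem_enum mem_prev mem_enum.
  apply/rooted_markedP; exists P, (prev (enum P) ord0); split=> //.
  rewrite inE /= DD; apply/exists_inP; exists P; rewrite // cP eqxx /=.
  by apply/imsetP; exists (prev (enum P) ord0); rewrite ?nx.
move=> X Y /rooted_markedP[P [x [XM PX cP xP [nx eX]]]].
move=> /rooted_markedP[Q [y [YM QY cQ yQ [ny eY]]]] E.
have EPQ : P = Q.
  apply: (big_piece_uniq (r := r) (D := X.1)); rewrite ?E //; last by rewrite -E.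
  by move: YM; rewrite inE => /andP[].
have Exy : x = y.
  by subst Q; rewrite -(prev_next (enum_uniq P) x) -(prev_next (enum_uniq P) y) nx ny.
by case: X Y E eX eY {XM PX YM QY} => D e [D' e'] /= -> -> ->; rewrite Exy.
Qed.

Lemma iter_ordS0 t : iter t (@ordS s) ord0 = ord0 -> t %% s = 0.
Proof. by move/(congr1 val); rewrite val_iter_ordS /= add0n. Qed.

(** A rotation keeps the direction of the marked edge, so the end at 0 goes to the end at 0 and the
    rotation is a full turn. The mark thus removes any rotational symmetry of the dissection. *)
Lemma rooted_marked_inj X t : X \in rooted_marked ->
  rotate_marked t X \in rooted_marked -> rotate_marked t X = X.
Proof.
case/rooted_markedP => P [x [XM PX cP xP [nx eX]]].
case/rooted_markedP => Q [y [YM QY cQ yQ [ny eY]]].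
have EQ : Q = rotate t P.
  apply: (big_piece_uniq (r := r) (D := [set rotate t d | d in X.1])) => //.
  - by move: YM; rewrite inE => /andP[].
  - by rewrite mem_pieces_rotate.
  - by rewrite card_rotate.
have nx' : next (enum Q) (iter t (@ordS s) x) = iter t (@ordS s) ord0.
  by rewrite EQ next_rotate // nx.
move: eY; rewrite /= eX rotate_set2 => /set2_inj[] [E1 E2].
  by rewrite -rotate_mod iter_ordS0 ?rotate0.
(* The marked edge would be reversed, so Q would be a 2-gon. *)
have Q0 : ord0 \in Q by rewrite -ny -mem_enum mem_next mem_enum.
have [_ H1] := follows_next yQ; have [_ H2] := follows_next Q0.
have y0 : next (enum Q) ord0 = y by rewrite -E1 nx' E2.
rewrite ny in H1; rewrite y0 in H2.
suff /subset_leq_card : Q \subset [set y; ord0].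
  rewrite cQ => Hr; have := leq_trans r3 (leq_trans Hr (subset_leq_card (subxx _))).
  by rewrite cards2; case: eqP.
apply/subsetP => z zQ; rewrite !inE.
have [->|/eqP zy] := eqVneq z y => //=; apply/eqP/val_inj => /=.
have zy' : val z <> val y by move=> /val_inj.
case: H1 => [] [] /= H11 H12; case: H2 => [] [] /= H21 H22;
  have := H12 z zQ; have := H22 z zQ; move: zy' => /=; lia.
Qed.

Lemma card_marked_dissection_classes :
  #|marked_dissection_classes s r| = #|rooted_dissections|.
Proof.
have eqv := rotation_equiv_rel (ltn0Sn p).
have part : partition (marked_dissection_classes s r) (marked_dissections s r).
  by apply: equivalence_partitionP => X Y Z _ _ _; apply: eqv.
rewrite -card_rooted_marked; apply/esym/card_transversal.
apply/and3P; split; first exact: part.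
  by apply/subsetP => X /rooted_markedP[P [x []]].
apply/forall_inP => _ /imsetP[X XM ->].
have [P PX [x xP [cP eX]]] : exists2 P, P \in pieces X.1 &
    exists2 x, x \in P & #|P| = r /\ X.2 = [set x; next (enum P) x].
  move: XM; rewrite inE => /andP[_ /exists_inP[P PX /andP[/eqP cP /imsetP[x xP ->]]]].
  by exists P => //; exists x.
(* This [t] brings the end of the marked edge to 0; if the end is already there, t = s is a full
   turn. *)
set t := s - next (enum P) x; set Y := rotate_marked t X.
have E0 : iter t (@ordS s) (next (enum P) x) = ord0.
  apply: val_inj; rewrite val_iter_ordS /= /t subnKC ?modnn //.
  exact: ltnW (ltn_ord _).
have YM : Y \in marked_dissections s r by apply: marked_rotate.
have YR : Y \in rooted_marked.
  apply/rooted_markedP; exists (rotate t P), (iter t (@ordS s) x); split=> //.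
  - by rewrite mem_pieces_rotate.
  - by rewrite card_rotate.
  - by rewrite mem_rotate.
  by rewrite next_rotate // E0 /= eX rotate_set2 E0.
have XY : rotation_equiv X Y by apply/rotation_equivP => //; exists t.
apply/cards1P; exists Y; apply/setP => Z; apply/setIP/set1P => [[ZR]|->]; last first.
  by split=> //; rewrite [_ \in _]in_set YM XY.
rewrite [_ \in _]in_set => /andP[ZM XZ].
have: rotation_equiv Y Z.
  by have /equivalence_relP[_ /(_ _ _ XY)<-] := eqv.
by case/rotation_equivP => // u EZ; rewrite EZ in ZR *; apply: rooted_marked_inj.
Qed.

End Classes.

(** * Forests of binary trees *)

(* A forest of binary trees whose leaves are consecutive unit intervals ending
   at s, grown from right to left: a leaf is put in front, a node joins the first
   two trees.  B lists the endpoints of the intervals spanned by the trees, and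
   (a, w, b) in N is an internal node over [a, b] whose children meet at w. *)
Inductive conf (s : nat) : seq nat -> seq (nat * nat * nat) -> Prop :=
| conf_nil : conf s [:: s] [::]
| conf_leaf x B N : conf s (x.+1 :: B) N -> conf s [:: x, x.+1 & B] N
| conf_node a w b B N :
    conf s [:: a, w, b & B] N -> conf s [:: a, b & B] ((a, w, b) :: N).

Definition arcs (N : seq (nat * nat * nat)) : seq (nat * nat) :=
  [seq (c.1.1, c.2) | c <- N].

Definition edge (N : seq (nat * nat * nat)) : rel nat :=
  fun x y => (y == x.+1) || ((x, y) \in arcs N).

Lemma arcsP N x y : reflect (exists w, (x, w, y) \in N) ((x, y) \in arcs N).
Proof.
apply: (iffP mapP) => [[[[a w] b] cN [-> ->]]|[w cN]]; first by exists w.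
by exists (x, w, y).
Qed.

Lemma arcs_cons a w b N : arcs ((a, w, b) :: N) = (a, b) :: arcs N.
Proof. by []. Qed.

Lemma edge_cons c N x y : edge N x y -> edge (c :: N) x y.
Proof. by case/orP => H; rewrite /edge /= ?inE H ?orbT. Qed.

Section ConfTheory.

Variable s : nat.
Implicit Types (B : seq nat) (N : seq (nat * nat * nat)).

Lemma conf_sorted B N : conf s B N -> sorted ltn B /\ last 0 B = s.
Proof.
elim=> {B N} [//|x B N _ [/= -> ->]|a w b B N _ [/= + <-]]; first by rewrite ltnSn.
by case/and3P => aw wb ->; rewrite (ltn_trans aw wb).
Qed.

Lemma conf_head_last B N : conf s B N -> head 0 B \in B /\ s \in B.
Proof.
move=> C; have [_ <-] := conf_sorted C.
suff : B != [::] by case: (B) => // h B' _; split; [exact: mem_head|exact: mem_last].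
by case: C.
Qed.

Lemma conf_range B N p : conf s B N -> p \in B -> head 0 B <= p <= s.
Proof.
move=> C; have [+ <-] := conf_sorted C; case: B {C} => //= h B.
elim: B h p => /= [h p _|q B IH h p /andP[hq pq]].
  by rewrite inE => /eqP->; rewrite leqnn.
rewrite inE => /orP[/eqP->|/(IH q p pq)]; last lia.
by have := IH q q pq (mem_head _ _); lia.
Qed.

Lemma conf_node_lt B N x w y : conf s B N -> (x, w, y) \in N ->
  [/\ head 0 B <= x, x < w, w < y & y <= s].
Proof.
move=> C; elim: C x w y => {B N} [//|h B N _ IH x w y|a w' b B N C IH x w y].
  by move/IH => [] /= *; split=> //; lia.
rewrite inE => /orP[/eqP[-> -> ->]|/IH //].
have [/= /and3P[aw wb _] _] := conf_sorted C.
have := @conf_range _ _ b C; rewrite !inE eqxx !orbT => /(_ isT) /=.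
by split=> //; lia.
Qed.

Lemma conf_arc_lt B N x y : conf s B N -> (x, y) \in arcs N ->
  [/\ head 0 B <= x, x.+1 < y & y <= s].
Proof. by move=> C /arcsP[w /(conf_node_lt C)[? ? ? ?]]; split=> //; lia. Qed.

(** [conf_node] deletes w from the list in the very step that puts the first arc over w, so a point
    still listed has no arc above it. *)
Lemma conf_straddle B N p x y : conf s B N -> p \in B -> (x, y) \in arcs N ->
  x < p < y -> False.
Proof.
move=> C; elim: C p x y => {B N} [//|h B N C IH p x y|a w b B N C IH p x y].
  rewrite inE => /orP[/eqP-> H2 H3|]; last exact: IH.
  by have [/= ? ? ?] := conf_arc_lt C H2; lia.
move=> pB; have pB' : p \in [:: a, w, b & B] by move: pB; rewrite !inE => /orP[->|->]; rewrite ?orbT.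
rewrite arcs_cons inE => /orP[/eqP[-> ->]|H] H2; last exact: IH H2.
have [/= /and3P[aw wb pb] _] := conf_sorted C.
have bB : all (ltn b) B by apply: order_path_min pb; apply: ltn_trans.
move: pB; rewrite !inE => /or3P[/eqP||/(allP bB) /=]; lia.
Qed.

Lemma conf_sub_edges B N : conf s B N ->
  sorted (edge N) B /\
  forall x w y, (x, w, y) \in N -> edge N x w /\ edge N w y.
Proof.
elim=> {B N} [//|x B N _ [/= -> H]|a w b B N _ [/= /and3P[aw wb pb] H]].
  by rewrite /edge eqxx.
split.
  apply/andP; split; first by rewrite /edge arcs_cons mem_head orbT.
  by apply: sub_path pb => u v; apply: edge_cons.
move=> x w' y; rewrite inE => /orP[/eqP[-> -> ->]|/H[]]; by split; apply: edge_cons.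
Qed.

Lemma conf_noncrossing B N x y u v : conf s B N -> (x, y) \in arcs N ->
  (u, v) \in arcs N -> x < u -> u < y -> y < v -> False.
Proof.
move=> C; elim: C x y u v => {B N} [//|//|a w b B N C IH x y u v].
rewrite !arcs_cons !inE => /orP[/eqP[-> ->]|H1] /orP[/eqP[-> ->]|H2] xu uy yv.
- lia.
- by apply: (conf_straddle C _ H2 (p := b)); rewrite ?inE ?eqxx ?orbT //; lia.
- by have [/= ? ? ?] := conf_arc_lt C H1; lia.
- exact: IH H1 H2 xu uy yv.
Qed.

(** When a node is created its split point w is still listed, so no earlier arc passes over w. The
    arcs over w are the node's own and later ones, which enclose it. In [pieces_dis] this controls
    an edge that would skip the apex of a triangle. *)
Lemma conf_node_inside B N u v x w y : conf s B N -> (u, v) \in arcs N ->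
  (x, w, y) \in N -> u < w -> w < v -> u <= x /\ y <= v.
Proof.
move=> C; elim: C u v x w y => {B N} [//|//|a w b B N C IH u v x w' y].
rewrite !arcs_cons !inE => /orP[/eqP[-> ->]|H1] /orP[/eqP[-> -> ->]|H2] uw wv.
- by [].
- have [/= ax xw wy ys] := conf_node_lt C H2; split=> //; rewrite leqNgt; apply/negP => yb.
  have H3 : (x, y) \in arcs N by apply/arcsP; exists w'.
  by apply: (conf_straddle C _ H3 (p := b)); rewrite ?inE ?eqxx ?orbT //; lia.
- by case: (conf_straddle C _ H1 (p := w)); rewrite ?inE ?eqxx ?orbT //; lia.
- exact: IH H1 H2 uw wv.
Qed.

Lemma conf_new_arc a w b B N : conf s [:: a, w, b & B] N -> (a, b) \notin arcs N.
Proof.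
move=> C; apply/negP => H; have [/= /and3P[aw wb _] _] := conf_sorted C.
by apply: (conf_straddle C _ H (p := w)); rewrite ?inE ?eqxx ?orbT //; lia.
Qed.

Lemma conf_uniq B N : conf s B N -> uniq (arcs N).
Proof. by elim=> {B N} //= a w b B N C ->; rewrite (conf_new_arc C). Qed.

Lemma conf_size B N : conf s B N -> head 0 B + (size B).-1 + size N = s.
Proof. by elim=> {B N} /= [|x B N _|a w b B N _]; lia. Qed.

(** The split points can be recovered from the arcs: if two forests split (a, b) at w < w', the link
    from a to w' in the second would be an arc over w, which is still listed in the first. Whether
    the last rule was a leaf or a node is visible in the first two entries of B. *)
Lemma conf_inj B N N' : conf s B N -> conf s B N' -> arcs N =i arcs N' -> N = N'.
Proof.
move=> C; elim: C N' => {B N}.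
- move=> N' _ H; case: N' H => // [[[a w] b] N'] /(_ (a, b)).
  by rewrite arcs_cons mem_head.
- move=> x B N C IH N' C'; inversion C' as [|x' B' N1 C1 E1 E2|a w b B' N1 C1 E1 E2]; subst.
    exact: IH.
  by have [/= /and3P[aw wb _] _] := conf_sorted C1; lia.
move=> a w b B N C IH N' C'; inversion C' as [|x' B' N1 C1 E1 E2|a' w' b' B' N1 C1 E1 E2]; subst.
  by have [/= /and3P[aw wb _] _] := conf_sorted C; lia.
rewrite !arcs_cons => H.
have H1 : arcs N =i arcs N1.
  move=> c; have := H c; rewrite !inE; case: eqP => [->|//].
  by rewrite (negbTE (conf_new_arc C)) (negbTE (conf_new_arc C1)).
have [/= /and3P[aw wb _] _] := conf_sorted C.
have [/= /and3P[aw' wb' _] _] := conf_sorted C1.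
have [/= /and3P[ew _ _] _] := conf_sub_edges C.
have [/= /and3P[ew' _ _] _] := conf_sub_edges C1.
suff Ew : w = w' by subst w'; congr (_ :: _); apply: IH.
case: (ltngtP w w') => // ww.
  case/orP: ew' => [/eqP|]; first lia.
  by rewrite -H1 => H2; case: (conf_straddle C _ H2 (p := w)); rewrite ?inE ?eqxx ?orbT //; lia.
case/orP: ew => [/eqP|]; first lia.
by rewrite H1 => H2; case: (conf_straddle C1 _ H2 (p := w')); rewrite ?inE ?eqxx ?orbT //; lia.
Qed.

(** Undoing the last rule leaves r-1 trees, or r+1 trees and one node less; both lower the induction
    measure 2m+r by one. The solution is the ballot number, written additively to avoid truncated
    subtraction. By [conf_size] the forest starts at s-r-m, whence the bound on r+m. *)
Lemma ex_confs r m : r + m <= s ->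
  exists L : seq (seq nat * seq (nat * nat * nat)), [/\ uniq L,
    forall c, c \in L <-> [/\ conf s c.1 c.2, size c.1 = r.+1 & size c.2 = m] &
    if r is r'.+1 then size L + 'C(m + m + r', m + r) = 'C(m + m + r', m + r')
    else size L = (m == 0)].
Proof.
have [l] := ubnP (m + m + r); elim: l r m => // l IH [|r] m lt_l rms.
  exists (if m == 0 then [:: ([:: s], [::])] else [::]); split; try by case: eqP.
  move=> [B N] /=; split.
    by case: eqP => // ->; rewrite inE => /eqP[-> ->]; split=> //; constructor.
  by case=> C; case: C => //= _ <-; rewrite eqxx mem_head.
have [||L1 [uL1 mL1 sL1]] := IH r m; [lia|lia|].
pose leaf (c : seq nat * seq (nat * nat * nat)) := ((head 0 c.1).-1 :: c.1, c.2).
have uleaf : uniq (map leaf L1).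
  by rewrite map_inj_uniq // => -[B N] [B' N'] [_ -> ->].
have mleaf B N : (B, N) \in map leaf L1 <->
    exists x B', [/\ B = [:: x, x.+1 & B'], conf s (x.+1 :: B') N,
                     size B = r.+2 & size N = m].
  split=> [/mapP[[B0 N0] /mL1[/= C sB sN] [-> ->]]|[x [B' [-> C [sB] sN]]]].
    case: B0 C sB => // h B0 C /= sB.
    have := conf_size C; rewrite /= sN; case: h C => [|x] C H; first by move: sB H; lia.
    by exists x, B0; split; rewrite //= sB.
  by apply/mapP; exists (x.+1 :: B', N) => //; apply/mL1; split; rewrite //= sB.
case: m => [|m] in lt_l rms sL1 mL1 mleaf *.
  exists (map leaf L1); split=> //.
    move=> [B N]; split=> [/mleaf[x [B' [-> C sB sN]]]|[/= C sB sN]].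
      by split=> //; constructor.
    apply/mleaf; case: C sB sN => [|x B' N' C|//] //= sB sN.
    by exists x, B'.
  rewrite size_map !add0n binn bin_small ?addn0 //.
  by case: (r) sL1 => [//|r' /=]; rewrite !add0n binn bin_small // addn0.
have [||L2 [uL2 mL2 sL2]] := IH r.+2 m; [lia|lia|].
pose node (c : seq nat * seq (nat * nat * nat)) :=
  if c.1 is [:: a, w, b & B] then ([:: a, b & B], (a, w, b) :: c.2) else c.
have unode : uniq (map node L2).
  rewrite map_inj_in_uniq // => -[B N] [B' N'] /mL2[/= _ sB _] /mL2[/= _ sB' _].
  case: B sB => [|a [|w [|b B]]] //= sB; case: B' sB' => [|a' [|w' [|b' B']]] //= sB'.
  by case=> *; subst.
have mnode B N : (B, N) \in map node L2 <->
    exists a w b B' N', [/\ B = [:: a, b & B'], N = (a, w, b) :: N',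
      conf s [:: a, w, b & B'] N', size B = r.+2 & size N = m.+1].
  split=> [/mapP[[B0 N0] /mL2[/= C sB sN]]|[a [w [b [B' [N' [-> -> C [sB] [sN]]]]]]]].
    case: B0 C sB => [|a [|w [|b B0]]] //= C [sB] [-> ->].
    by exists a, w, b, B0, N0; split; rewrite //= ?sB ?sN.
  by apply/mapP; exists ([:: a, w, b & B'], N') => //; apply/mL2; split; rewrite //= sB.
exists (map leaf L1 ++ map node L2); split.
- rewrite cat_uniq uleaf unode andbT; apply/hasPn => -[B N] /mnode.
  case=> a [w [b [B' [N' [-> _ C _ _]]]]]; apply/negP => /mleaf[x [B'' [[E1 E2 _] _ _ _]]].
  by have [/= /and3P[aw wb _] _] := conf_sorted C; lia.
- move=> [B N]; rewrite mem_cat; split.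
    case/orP => [/mleaf[x [B' [-> C sB sN]]]|/mnode[a [w [b [B' [N' [-> -> C sB sN]]]]]]];
      by split=> //; constructor.
  case=> /= C sB sN; apply/orP; case: C sB sN => [|x B' N' C|a w b B' N' C] //= sB sN.
    by left; apply/mleaf; exists x, B'.
  by right; apply/mnode; exists a, w, b, B', N'.
(* For a single tree with a node the leaf term is zero; in Pascal's rule the symmetry C(2m+1, m+1) =
   C(2m+1, m) makes up for it. *)
rewrite size_cat !size_map; case: r => [|r] in sL1 sL2 {uleaf unode mleaf mnode IH lt_l rms mL1 mL2} *.
  move: sL2; rewrite /= in sL1; rewrite sL1 !addn0 add0n.
  have -> : m + m + 1 = m + m.+1 by lia.
  have -> : m + 2 = m.+2 by lia.
  have -> : m.+1 + 1 = m.+2 by lia.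
  have -> : m + 1 = m.+1 by lia.
  rewrite [m.+1 + m.+1]addSn !binS.
  have -> : 'C(m + m.+1, m.+1) = 'C(m + m.+1, m).
    by rewrite -(bin_sub (m := m)) ?leq_addr // addKn.
  lia.
move: sL1 sL2.
have -> : m + m + r.+2 = m.+1 + m.+1 + r by lia.
have -> : m.+1 + m.+1 + r.+1 = (m.+1 + m.+1 + r).+1 by lia.
have -> : m.+1 + r.+2 = (m + r).+3 by lia.
have -> : m + r.+3 = (m + r).+3 by lia.
have -> : m + r.+2 = (m + r).+2 by lia.
have -> : m.+1 + r.+1 = (m + r).+2 by lia.
have -> : m.+1 + r = (m + r).+1 by lia.
rewrite !binS; lia.
Qed.

End ConfTheory.

(** * The dissection of a forest *)

Ltac arith :=
  repeat match goal with
  | H : ?T |- _ =>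
    lazymatch type of T with
    | Prop =>
      lazymatch T with
      | @eq ?A _ _ => tryif unify A nat then fail else clear H
      | or _ _ => fail
      | and _ _ => fail
      | not _ => fail
      | is_true (leq _ _) => fail
      | is_true (andb _ _) => fail
      | is_true (orb _ _) => fail
      | is_true (negb _) => fail
      | _ => clear H
      end
    | _ => fail
    end
  end; lia.

Lemma pred_gap (q : pred nat) a c z : q a -> a < z -> q c -> z < c -> ~~ q z ->
  exists b b', [/\ q b, q b', b < z, z < b' & forall t, q t -> t <= b \/ b' <= t].
Proof.
move=> qa az qc zc nqz.
have ex1 : exists n, q n && (n < z) by exists a; rewrite qa.
have ex2 : exists n, q n && (z < n) by exists c; rewrite qc.
have ub n : q n && (n < z) -> n <= z by case/andP => _ /ltnW.
case: (ex_maxnP ex1 ub) => b /andP[qb bz] maxb.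
case: (ex_minnP ex2) => b' /andP[qb' zb'] minb'.
exists b, b'; split=> // t qt; case: (ltngtP t z) => tz.
- by left; apply: maxb; rewrite qt.
- by right; apply: minb'; rewrite qt.
- by move: nqz; rewrite -tz qt.
Qed.

Lemma set_gap s (Q : {set 'I_s}) (a c : 'I_s) z : a \in Q -> a < z -> c \in Q ->
  z < c -> (forall v : 'I_s, v \in Q -> val v <> z) ->
  exists b b' : 'I_s, [/\ b \in Q, b' \in Q, b < z, z < b' &
    forall t : 'I_s, t \in Q -> t <= b \/ b' <= t].
Proof.
move=> aQ az cQ zc nz; pose q := [pred n | n \in [seq val v | v <- enum Q]].
have qP (v : 'I_s) : q v = (v \in Q) by rewrite /= mem_map ?mem_enum //; apply: val_inj.
have [|||b [b' [/mapP[v] + -> /mapP[v'] + -> bz zb' H]]] := @pred_gap q a c z _ az _ zc.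
- by rewrite qP.
- by rewrite qP.
- by apply/negP => /mapP[v]; rewrite mem_enum => /nz + E; rewrite E.
rewrite !mem_enum => vQ v'Q; exists v, v'; split=> // t tQ.
by apply: H; rewrite qP.
Qed.

Lemma sorted_adjacent (e : rel nat) (B : seq nat) x y : sorted ltn B -> sorted e B ->
  x \in B -> y \in B -> x < y -> (forall t, t \in B -> t <= x \/ y <= t) -> e x y.
Proof.
elim: B => // h B IH /= pB eB; rewrite !inE.
have lt_all := allP (order_path_min ltn_trans pB).
case/predU1P => [->|xB] /predU1P[->|yB] xy H; first by rewrite ltnn in xy.
- case: B pB eB lt_all H yB {IH} => // h' B /= /andP[hh' pB] /andP[e1 _] lt_all H.
  rewrite inE => /predU1P[->//|yB].
  have := allP (order_path_min ltn_trans pB) y yB.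
  by have := H h'; rewrite !inE eqxx orbT => /(_ isT) /=; lia.
- by have /= := lt_all x xB; lia.
- apply: IH => //; [exact: path_sorted pB|exact: path_sorted eB|].
  by move=> t tB; apply: H; rewrite inE tB orbT.
Qed.

Lemma card3_edges s (Q d : {set 'I_s}) :
  #|Q| = 3 -> d \subset Q -> #|d| = 2 -> d \in polygon_edges Q.
Proof.
move=> Q3 /subsetP dQ /eqP/cards2P[x [y [ne E]]].
wlog xy : x y ne E / x < y => [H|].
  case: (ltngtP x y) => [|yx|/val_inj E']; first exact: H.
    by apply: (H y x) => //; rewrite 1?eq_sym // setUC.
  by rewrite E' eqxx in ne.
have xQ : x \in Q by rewrite dQ // E set21.
have yQ : y \in Q by rewrite dQ // E set22.
have : #|Q :\ x :\ y| = 1.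
  have yQ' : y \in Q :\ x by rewrite !inE eq_sym ne yQ.
  by have := cardsD1 x Q; rewrite (cardsD1 y (Q :\ x)) xQ yQ' Q3 => -[].
move/eqP/cards1P => [z Ez].
have Qz t : t \in Q -> [\/ t = x, t = y | t = z].
  move=> tQ; have [->|tx] := eqVneq t x; first by constructor 1.
  have [->|ty] := eqVneq t y; first by constructor 2.
  constructor 3; apply/eqP; rewrite -in_set1 -Ez !inE tx ty //.
rewrite E; apply/polygon_edgesP => //; split=> //; split=> //.
case: (ltnP z x) => zx; first by left=> t /Qz[] ->; lia.
case: (ltnP y z) => yz; first by left=> t /Qz[] ->; lia.
by right=> t /Qz[] ->; lia.
Qed.

Section Geometry.

Variable p : nat.
Local Notation s := p.+1.
Implicit Types (P Q d e : {set 'I_s}) (D : {set {set 'I_s}}).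
Implicit Types (B : seq nat) (N : seq (nat * nat * nat)).

(* The last vertex s of the polygon unrolled at 0 is 0 again. *)
Definition vertex (a : nat) : 'I_s := Ordinal (ltn_pmod a (ltn0Sn p)).

Definition chord (a b : nat) : {set 'I_s} := [set vertex a; vertex b].

Definition dis N : {set {set 'I_s}} := [set d in [seq chord c.1 c.2 | c <- arcs N]].

(** No vertex has value s, so the endpoint s of the chain drops out and 0 stands for both ends. *)
Definition poly B : {set 'I_s} := [set v | val v \in B].

Definition tri (c : nat * nat * nat) : {set 'I_s} :=
  [set vertex c.1.1; vertex c.1.2; vertex c.2].

Lemma val_vertex a : a < s -> val (vertex a) = a.
Proof. exact: modn_small. Qed.

Lemma vertex_s : vertex s = ord0.
Proof. by apply: val_inj; rewrite /= modnn. Qed.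

Lemma vertex_val (x : 'I_s) : vertex x = x.
Proof. by apply: val_inj; rewrite val_vertex. Qed.

Lemma vertex_cases a : a <= s ->
  (a < s /\ val (vertex a) = a) \/ (a = s /\ val (vertex a) = 0).
Proof.
rewrite leq_eqVlt => /predU1P[->|lt]; last by left; rewrite val_vertex.
by right; rewrite vertex_s.
Qed.

Lemma disP N d : reflect (exists x y : nat, (x, y) \in arcs N /\ d = chord x y) (d \in dis N).
Proof.
rewrite inE; apply: (iffP mapP) => [[[x y] H ->]|[x [y [H ->]]]].
  by exists x, y.
by exists (x, y).
Qed.

Lemma sideP (x y : 'I_s) : x < y ->
  [set x; y] \in polygon_edges [set: 'I_s] <-> y = x.+1 :> nat \/ (x = 0 :> nat /\ y = p :> nat).
Proof.
move=> xy; have ys := ltn_ord y; split.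
  case/polygon_edgesP => // _ [_ [H|H]].
    by left; have := H (vertex x.+1) (in_setT _); rewrite /= modn_small; arith.
  right; have := H ord0 (in_setT _); have := H (vertex p) (in_setT _).
  by rewrite /= modn_small; arith.
move=> H; apply/polygon_edgesP; rewrite // !in_setT; split=> //; split=> //.
by case: H => H; [left|right] => z _; have := ltn_ord z; arith.
Qed.

Section FromConf.

Variables (B : seq nat) (N : seq (nat * nat * nat)).
Hypothesis C : conf s B N.

Let strad (x y t : nat) : (x, y) \in arcs N -> t \in B -> t <= x \/ y <= t.
Proof.
move=> H tB; case: (leqP t x) => [|xt]; [by left|right].
rewrite leqNgt; apply/negP => ty.
by apply: (conf_straddle C tB H); rewrite xt.
Qed.

Let arc_lt (x y : nat) : (x, y) \in arcs N -> x.+1 < y /\ y <= s.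
Proof. by move=> /(conf_arc_lt C)[]. Qed.

Let edge_strad (x y t : nat) : edge N x y -> t \in B -> t <= x \/ y <= t.
Proof. by case/orP => [/eqP->|]; [arith|apply: strad]. Qed.

Let edge_lt x y : edge N x y -> x < y.
Proof. by case/orP => [/eqP->//|/arc_lt]; arith. Qed.

Let edge_arc x y : edge N x y -> x.+1 < y -> (x, y) \in arcs N.
Proof. by case/orP => [/eqP->|//]; rewrite ltnn. Qed.

(** A diagonal at 0 has two possible sources, since an arc ending at s is folded onto one. *)
Lemma mem_dis (x y : 'I_s) : x < y ->
  [set x; y] \in dis N <-> (x : nat, y : nat) \in arcs N \/ (x = 0 :> nat /\ (y : nat, s) \in arcs N).
Proof.
move=> xy; have xs := ltn_ord x; have ys := ltn_ord y; split.
  case/disP => u [v [H E]]; have [uv vs] := arc_lt H.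
  have us : u < s by arith.
  have Eu := val_vertex us.
  case: (vertex_cases vs) => [] [vs' Ev];
    case: (set2_inj E) => [] [Ex Ey]; move: Eu Ev; rewrite -Ex -Ey => Eu Ev.
  - by left; rewrite -/(val x) -/(val y) Eu Ev.
  - by move: xy; rewrite -/(val x) -/(val y) Eu Ev; arith.
  - by move: xy; rewrite -/(val x) -/(val y) Eu Ev; arith.
  - by right; split=> //; rewrite -/(val y) Eu -vs'.
case=> [H|[x0 H]]; apply/disP.
  by exists x, y; rewrite /chord !vertex_val.
exists y, s; split=> //; rewrite /chord vertex_val vertex_s setUC; congr [set _; _].
exact: val_inj.
Qed.

Lemma mem_sides_dis (x y : 'I_s) : x < y ->
  [set x; y] \in polygon_edges [set: 'I_s] :|: dis N <->
  edge N x y \/ (x = 0 :> nat /\ edge N y s).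
Proof.
move=> xy; rewrite inE /edge; split.
  case/orP => [/sideP-/(_ xy)[->|[-> ->]]|/mem_dis-/(_ xy)[->|[-> ->]]];
    rewrite ?eqxx ?orbT; auto.
case=> [/orP[/eqP H|H]|[x0 /orP[/eqP H|H]]]; apply/orP.
- by left; apply/sideP => //; left.
- by right; apply/mem_dis => //; left.
- by left; apply/sideP => //; right; arith.
- by right; apply/mem_dis => //; right.
Qed.

(** The excluded pair (0, s) is the one whose ends become the same vertex. *)
Lemma chord_sides_dis x y : edge N x y -> y <= s -> ~~ ((x == 0) && (y == s)) ->
  chord x y \in polygon_edges [set: 'I_s] :|: dis N.
Proof.
move=> H ys xys; have xy := edge_lt H.
have xs : x < s by arith.
have Ex := val_vertex xs.
case: (vertex_cases ys) => [] [ys' Ey].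
  apply/mem_sides_dis; first by move: Ex Ey => /= -> ->.
  by left; move: Ex Ey => /= -> ->.
rewrite /chord setUC; apply/mem_sides_dis; move: Ex Ey => /= -> ->; first arith.
by right; rewrite -ys'.
Qed.

Let edges_B : sorted (edge N) B.
Proof. by have [] := conf_sub_edges C. Qed.

Let ltn_B : sorted ltn B.
Proof. by have [] := conf_sorted C. Qed.

Let s_B : s \in B.
Proof. by have [] := conf_head_last C. Qed.

Let le_s t : t \in B -> t <= s.
Proof. by move/(conf_range C)/andP => []. Qed.

Lemma card_poly : #|poly B| = (size B).-1.
Proof.
have uB : uniq B by apply: sorted_uniq ltn_B; [apply: ltn_trans|apply: ltnn].
rewrite -(size_rem s_B) cardE -(size_map val); apply/perm_size/uniq_perm.
- by rewrite map_inj_uniq ?enum_uniq //; apply: val_inj.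
- exact: rem_uniq.
move=> t; rewrite mem_rem_uniq // !inE; apply/mapP/andP => [[v + ->]|[ts tB]].
  by rewrite mem_enum inE => vB; have := ltn_ord v; rewrite ltn_neqAle => /andP[].
have ts' : t < s by rewrite ltn_neqAle ts le_s.
exists (vertex t); last by rewrite val_vertex.
by rewrite mem_enum inE val_vertex.
Qed.

Let node_arc (x w y : nat) : (x, w, y) \in N -> (x, y) \in arcs N.
Proof. by move=> H; apply/arcsP; exists w. Qed.

(** Such corners exist as soon as r >= 4. As no arc passes over a corner, an arc from 0 ends at or
    before [p1] and an arc to s starts at or after [pl]: folding keeps the two kinds apart and turns
    no arc into a side. *)
Variables (p1 q pl : nat).
Hypothesis B0 : 0 \in B.
Hypotheses (p1B : p1 \in B) (qB : q \in B) (plB : pl \in B).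
Hypotheses (p1_gt0 : 0 < p1) (p1q : p1 < q) (qpl : q < pl) (pls : pl < s).

Lemma dis_diagonals : dis N \subset diagonals s.
Proof.
apply/subsetP => d /disP[x [y [H ->]]]; have [xy ys] := arc_lt H.
have S := strad H; have xs : x < s by arith.
have Ex := val_vertex xs.
have S1 := S _ p1B; have S2 := S _ qB; have S3 := S _ plB.
have ne : vertex x != vertex y.
  by apply/eqP => /(congr1 val); rewrite Ex; case: (vertex_cases ys) => [] [? ->]; arith.
rewrite inE /chord cards2 ne /=.
case: (vertex_cases ys) => [] [ys' Ey].
  apply/negP => /sideP; move: Ex Ey => /= -> ->; arith.
apply/negP; rewrite setUC => /sideP; move: Ex Ey => /= -> ->; arith.
Qed.

(** Folding (x, s) to {0, x} makes its chord the one with the smallest endpoint, so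
    [conf_noncrossing] is needed with the two arcs in either order. *)
Lemma dis_noncrossing d e : d \in dis N -> e \in dis N -> ~~ crossing d e.
Proof.
case/disP => x [y [H ->]] /disP[u [v [H' ->]]]; apply/negP.
have [xy ys] := arc_lt H; have [uv vs] := arc_lt H'.
have xs : x < s by arith.
have us : u < s by arith.
have Ex := val_vertex xs; have Eu := val_vertex us.
have X1 : [|| u <= x, y <= u | v <= y].
  apply/negPn/negP; rewrite !negb_or -!ltnNge => /and3P[].
  exact: conf_noncrossing C H H'.
have X2 : [|| x <= u, v <= x | y <= v].
  apply/negPn/negP; rewrite !negb_or -!ltnNge => /and3P[].
  exact: conf_noncrossing C H' H.
have S1 := strad H qB; have S2 := strad H' qB.
have Cy := vertex_cases ys; have Cv := vertex_cases vs.
move=> /exists_inP[a + /exists_inP[b + /exists_inP[c + /exists_inP[f + /and3P[]]]]].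
move: Cy Cv Ex Eu; rewrite /chord.
move: (vertex x) (vertex y) (vertex u) (vertex v) => vx vy vu vv /= Cy Cv Ex Eu.
move=> /set2P Ha /set2P Hb /set2P Hc /set2P Hf ac cb bf.
have {Ha Hb} : (a = x :> nat /\ b = y :> nat /\ y < s) \/ (a = 0 :> nat /\ b = x :> nat /\ y = s).
  clear - ac cb Ha Hb Cy Ex xy; case: Ha Hb ac cb => -> [] ->; arith.
have {Hc Hf} : (c = u :> nat /\ f = v :> nat /\ v < s) \/ (c = 0 :> nat /\ f = u :> nat /\ v = s).
  clear - cb bf Hc Hf Cv Eu uv; case: Hc Hf cb bf => -> [] ->; arith.
clear - ac cb bf X1 X2 S1 S2 xy uv.
by case=> [] [? [? ?]] [] [? [? ?]]; arith.
Qed.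

Lemma is_dissection_dis : is_dissection (dis N).
Proof.
rewrite /is_dissection dis_diagonals; apply/forall_inP => d dd.
by apply/forall_inP => e ee; apply: dis_noncrossing.
Qed.

Lemma poly_piece : poly B \in pieces (dis N).
Proof.
have P2 : 2 < #|poly B|.
  have v3 : #|[set vertex 0; vertex p1; vertex q]| = 3.
    have E0 : val (vertex 0) = 0 by rewrite val_vertex.
    have E1 : val (vertex p1) = p1 by rewrite val_vertex //; arith.
    have E2 : val (vertex q) = q by rewrite val_vertex //; arith.
    rewrite setUC cardsU1 cards2 !inE -!(inj_eq val_inj) E0 E1 E2; arith.
  rewrite -v3; apply/subset_leq_card/subsetP => v; rewrite !inE.
  by case/orP => [/orP[]|] /eqP->; rewrite val_vertex //; arith.
have dis_edge (x y : 'I_s) : x < y -> [set x; y] \in dis N -> x \in poly B -> y \in poly B ->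
    [set x; y] \in polygon_edges (poly B).
  move=> xy /mem_dis-/(_ xy) H; rewrite !inE => xB yB; apply/polygon_edgesP; rewrite ?inE //.
  split=> //; split=> //.
  case: H => [H|[x0 H]]; [left|right] => z; rewrite inE => zB; have := @strad _ _ z H zB; have := ltn_ord z; arith.
rewrite inE P2 /=; apply/andP; split.
  apply/subsetP => e eP; have [|x [y [xy Ee xP yP]]] := polygon_edge_pair _ eP; first arith.
  move: eP; rewrite Ee => /polygon_edgesP-/(_ xy)[_ [_ H]]; apply/mem_sides_dis => //.
  rewrite !inE in xP yP; have ys := ltn_ord y.
  case: H => H; [left|right].
    apply: (sorted_adjacent ltn_B) => // t tB.
    have := le_s tB; rewrite leq_eqVlt => /predU1P[->|ts]; first arith.
    by have := H (vertex t); rewrite inE val_vertex // => /(_ tB); rewrite /= modn_small.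
  have x0 : x = 0 :> nat by have := H ord0; rewrite inE => /(_ B0) /=; arith.
  split=> //; apply: (sorted_adjacent ltn_B) => // t tB.
  have := le_s tB; rewrite leq_eqVlt => /predU1P[->|ts]; first arith.
  have := H (vertex t); rewrite inE val_vertex // => /(_ tB); rewrite /= modn_small //; arith.
apply/forall_inP => d dd; apply/implyP => /subsetP dP.
have := subsetP dis_diagonals d dd; rewrite inE => /andP[/cards2P[x [y [ne Ed]]] _].
have xP : x \in poly B by rewrite dP // Ed set21.
have yP : y \in poly B by rewrite dP // Ed set22.
rewrite Ed in dd *; case: (ltngtP x y) => [xy|yx|/val_inj E].
- exact: dis_edge.
- by rewrite setUC; apply: dis_edge => //; rewrite setUC.
- by rewrite E eqxx in ne.
Qed.

Lemma card_tri c : c \in N -> #|tri c| = 3.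
Proof.
case: c => [[x w] y] H; have [_ xw wy ys] := conf_node_lt C H.
have := strad (node_arc H) qB.
have xs : x < s by arith.
have ws : w < s by arith.
rewrite /tri /= setUC cardsU1 cards2 !inE -!(inj_eq val_inj) (val_vertex xs) (val_vertex ws).
by case: (vertex_cases ys) => [] [E ->]; arith.
Qed.

Lemma tri_piece c : c \in N -> tri c \in pieces (dis N).
Proof.
move=> cN; have c3 := card_tri cN; rewrite inE c3 /=; apply/andP; split; last first.
  apply/forall_inP => d dd; apply/implyP => dT; apply: card3_edges => //.
  by have := subsetP dis_diagonals d dd; rewrite inE => /andP[/eqP].
case: c cN c3 => [[x w] y] H; have [_ xw wy ys] := conf_node_lt C H => c3.
have [e1 e2] := (conf_sub_edges C).2 _ _ _ H.
have nz := strad (node_arc H) qB.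
have h1 : chord x w \in polygon_edges [set: 'I_s] :|: dis N by apply: chord_sides_dis => //; arith.
have h2 : chord w y \in polygon_edges [set: 'I_s] :|: dis N by apply: chord_sides_dis => //; arith.
have h3 : chord x y \in polygon_edges [set: 'I_s] :|: dis N.
  apply: chord_sides_dis => //; last arith.
  by rewrite /edge (node_arc H) orbT.
apply/subsetP => e eT; have [|u [v [uv -> uT vT]]] := polygon_edge_pair _ eT; first by rewrite c3.
have ne : u != v by apply/eqP => E; rewrite E ltnn in uv.
have chordC a b : [set vertex a; vertex b] = chord b a by rewrite setUC.
case/setUP: uT ne => [/set2P[]|/set1P] ->; case/setUP: vT => [/set2P[]|/set1P] ->;
  rewrite ?eqxx // => _; by [|rewrite chordC].
Qed.
(** The edge between the extreme vertices [q0 < q1] of Q comes either from an unrolled edge (q0,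
    q1), or from an edge (q1, s) with q0 = 0. This and the second smallest vertex decide which piece
    Q is. *)
Lemma pieces_dis Q : Q \in pieces (dis N) ->
  Q = poly B \/ exists2 c, c \in N & Q = tri c.
Proof.
rewrite inE => /and3P[Q3 /subsetP sQ /forall_inP dQ].
have [q0 [q1 [q0Q q1Q mQ]]] : exists q0 q1 : 'I_s,
    [/\ q0 \in Q, q1 \in Q & forall z : 'I_s, z \in Q -> q0 <= z <= q1].
  have /card_gt0P[a aQ] : 0 < #|Q| by arith.
  case: (arg_minnP (P := mem Q) val aQ) => q0 q0Q H0.
  case: (arg_maxnP (P := mem Q) val aQ) => q1 q1Q H1.
  by exists q0, q1; split=> // z zQ; rewrite H0 //=; apply: H1.
have big (x y : 'I_s) : ~ (forall z : 'I_s, z \in Q -> z = x \/ z = y).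
  move=> H; suff /subset_leq_card : Q \subset [set x; y].
    by rewrite cards2; case: (x != y); arith.
  by apply/subsetP => z /H; rewrite !inE => -[] ->; rewrite eqxx ?orbT.
have q01 : q0.+1 < q1.
  rewrite ltnNge; apply/negP => H; apply: (big q0 q1) => z /mQ Hz.
  have [Ez|Ez] : z = q0 :> nat \/ z = q1 :> nat by arith.
    by left; apply: val_inj.
  by right; apply: val_inj.
have consE (x y : 'I_s) : x \in Q -> y \in Q -> x < y ->
    (forall z : 'I_s, z \in Q -> z <= x \/ y <= z) ->
    edge N x y \/ (x = 0 :> nat /\ edge N y s).
  by move=> xQ yQ xy H; apply/mem_sides_dis => //; apply: sQ; apply/polygon_edgesP => //; auto.
have outE : edge N q0 q1 \/ (q0 = 0 :> nat /\ edge N q1 s).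
  apply/mem_sides_dis; [arith|apply: sQ; apply/polygon_edgesP; first arith].
  by split=> //; split=> //; right.
have nodiv (x y : 'I_s) : x \in Q -> y \in Q -> x < y -> [set x; y] \in dis N ->
    (forall z : 'I_s, z \in Q -> z <= x \/ y <= z) \/
    (forall z : 'I_s, z \in Q -> x <= z <= y).
  move=> xQ yQ xy H; have := dQ _ H.
  have -> : [set x; y] \subset Q by apply/subsetP => z; rewrite !inE => /orP[] /eqP->.
  by case/polygon_edgesP => // _ [_].
have nodiv1 (x y : 'I_s) : x \in Q -> y \in Q -> edge N x y ->
    (forall z : 'I_s, z \in Q -> z <= x \/ y <= z) \/
    (forall z : 'I_s, z \in Q -> x <= z <= y).
  move=> xQ yQ exy; have xy := edge_lt exy; case/orP: exy => [/eqP H|H].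
    by left=> z _; arith.
  by apply: nodiv => //; apply/mem_dis => //; left.
have eqv (z x : 'I_s) : z = x :> nat -> z = x by move/val_inj.
have q1s := ltn_ord q1.
(* Were the split point w of the node over (q0, q1) not in Q, the edge of Q passing over w would
   enclose [q0, q1] by [conf_node_inside], leaving Q only two vertices. Once w is in Q, the links
   (q0, w) and (w, q1) may not divide Q, so Q has no other vertex. *)
have caseA : edge N q0 q1 -> exists2 c, c \in N & Q = tri c.
  move=> e01; have a01 := edge_arc e01 q01; have [w wN] := arcsP _ _ _ a01.
  have [_ q0w wq1 _] := conf_node_lt C wN.
  have ws : w < s by arith.
  have vw := val_vertex ws.
  have wQ : vertex w \in Q.
    apply/negPn/negP => nwQ; have [|||b [b' [bQ b'Q bw wb' bb']]] := @set_gap _ Q q0 q1 w q0Q _ q1Q.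
    - by [].
    - by [].
    - by move=> v vQ E; case/negP: nwQ; rewrite -E vertex_val.
    have Hb := mQ _ bQ; have Hb' := mQ _ b'Q.
    have bb'lt : b < b' by arith.
    case: (consE b b' bQ b'Q bb'lt bb') => [e|[b0 e]].
      have [|Hb0 Hb1] := conf_node_inside C (edge_arc e _) wN bw wb'; first arith.
      by apply: (big q0 q1) => z zQ; have := mQ z zQ; have := bb' z zQ;
        case: (eqVneq z q0) => [|/eqP nz]; [left|right; apply: eqv;
          have : z <> q0 :> nat by [move/val_inj]; arith].
    have := strad a01 p1B; have := edge_strad e plB; arith.
  have [e0 e1] := (conf_sub_edges C).2 _ _ _ wN.
  exists (q0 : nat, w, q1 : nat) => //.
  have H0 : forall z : 'I_s, z \in Q -> z <= q0 \/ w <= z.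
    have [|H|H] := nodiv1 q0 (vertex w) q0Q wQ; first by rewrite -/(val _) vw.
      by move=> z /H; rewrite -/(val (vertex w)) vw.
    by have := H q1 q1Q; rewrite -/(val (vertex w)) vw; arith.
  have H1 : forall z : 'I_s, z \in Q -> z <= w \/ q1 <= z.
    have [|H|H] := nodiv1 (vertex w) q1 wQ q1Q; first by rewrite -/(val (vertex w)) vw.
      by move=> z /H; rewrite -/(val (vertex w)) vw.
    by have := H q0 q0Q; rewrite -/(val (vertex w)) vw; arith.
  apply/setP => z; rewrite !inE /= !vertex_val; apply/idP/idP.
    move=> zQ; have := H0 z zQ; have := H1 z zQ; have := mQ z zQ => Hz Hz1 Hz0.
    rewrite -!(inj_eq val_inj) vw /=; arith.
  by case/orP => [/orP[]|] /eqP->.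
case: (boolP (edge N q0 q1)) => [/caseA|ne01]; first by right.
case: outE => [e|[q00 eq1]]; first by rewrite e in ne01.
(* From here on 0 is in Q and plays the part of s. If (u, s) is an edge for the second smallest
   vertex u, then Q is the triangle below that edge; otherwise Q is the r-gon. *)
have [u [uQ u0 minu]] : exists u : 'I_s, [/\ u \in Q, 0 < u &
    forall z : 'I_s, z \in Q -> z = 0 :> nat \/ u <= z].
  have q1P : (q1 \in Q) && (0 < q1) by rewrite q1Q; arith.
  case: (arg_minnP (P := [pred z : 'I_s | (z \in Q) && (0 < z)]) val q1P) => u /andP[uQ u0] H.
  exists u; split=> // z zQ; case: (posnP z) => [|z0]; [by left|right].
  by apply: H; rewrite /= zQ.
have uq1 : u < q1.
  case: (ltngtP u q1) => // [lt|/eqv E]; first by have := mQ u uQ; arith.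
  case: (big q0 q1) => z zQ; have := mQ z zQ; have := minu z zQ; rewrite E.
  by case=> [z0|Hz] Hz'; [left|right]; apply: eqv; arith.
have u_lt := ltn_ord u.
have e0u : edge N q0 u \/ (q0 = 0 :> nat /\ edge N u s).
  by apply: consE => //; [arith|move=> z /minu; arith].
case: (boolP (edge N u s)) => [eus|neus].
  right; have [|w wN] := arcsP _ _ _ (edge_arc eus _); first arith.
  have [_ uw ws _] := conf_node_lt C wN.
  have vw := val_vertex ws.
  have wQ : vertex w \in Q.
    apply/negPn/negP => nwQ.
    have nw : forall v : 'I_s, v \in Q -> val v <> w.
      by move=> v vQ E; case/negP: nwQ; rewrite -E vertex_val.
    case: (ltngtP w q1) => wq1; last by case: (nw q1 q1Q).
      have [b [b' [bQ b'Q bw wb' bb']]] := set_gap uQ uw q1Q wq1 nw.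
      have b's := ltn_ord b'.
      have Hb := bb' u uQ; have bb'lt : b < b' by arith.
      case: (consE b b' bQ b'Q bb'lt bb') => [e|[b0 e]]; last arith.
      by have [|Hb0 Hb1] := conf_node_inside C (edge_arc e _) wN bw wb'; arith.
    by have [|Hb0 Hb1] := conf_node_inside C (edge_arc eq1 _) wN wq1 ws; arith.
  have [e0 e1] := (conf_sub_edges C).2 _ _ _ wN.
  exists (u : nat, w, s) => //.
  have H0 : forall z : 'I_s, z \in Q -> z <= u \/ w <= z.
    have [|H|H] := nodiv1 u (vertex w) uQ wQ; first by rewrite -/(val _) vw.
      by move=> z /H; rewrite -/(val (vertex w)) vw.
    by have := H q0 q0Q; arith.
  have H1 : forall z : 'I_s, z \in Q -> z <= w.
    case/orP: (e1) => [/eqP E|a1]; first by move=> z _; have := ltn_ord z; arith.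
    have [||H|H] := nodiv q0 (vertex w) q0Q wQ.
    - rewrite -/(val (vertex w)) vw; arith.
    - apply/mem_dis; first by rewrite -/(val (vertex w)) vw; arith.
      by right; rewrite -/(val (vertex w)) vw.
    - by have := H u uQ; rewrite -/(val (vertex w)) vw; arith.
    - by move=> z /H; rewrite -/(val (vertex w)) vw; arith.
  apply/setP => z; rewrite !inE vertex_s vertex_val; apply/idP/idP.
    move=> zQ; have := H0 z zQ; have := H1 z zQ; have := minu z zQ => Hz Hz1 Hz0.
    rewrite -!(inj_eq val_inj) vw /=; arith.
  case/orP => [/orP[]|] /eqP-> //.
  by rewrite -(eqv q0 ord0).
left; have e0u' : edge N q0 u by case: e0u => // -[_ e]; rewrite e in neus.
(* If Q skipped a corner, one of its edges would pass over that corner. The only other source of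
   such an edge, (u, s) folded onto {0, u}, has just been excluded. *)
have BQ (b : 'I_s) : val b \in B -> b \in Q.
  move=> bB; apply/negPn/negP => nbQ; have bs := ltn_ord b.
  have nb : forall v : 'I_s, v \in Q -> val v <> val b.
    by move=> v vQ /val_inj E; rewrite -E vQ in nbQ.
  have b0 : 0 < b by rewrite lt0n; apply/eqP => E; apply: (nb q0) => //=; arith.
  case: (ltngtP b q1) => bq1; last by case: (nb q1).
    have [|c [c' [cQ c'Q cb bc' cc']]] := set_gap q0Q _ q1Q bq1 nb; first by rewrite /=; arith.
    have cc'lt : c < c' by rewrite /= in cb bc'; arith.
    case: (consE c c' cQ c'Q cc'lt cc') => [e|[c0 e]].
      by have := edge_strad e bB; rewrite /= in cb bc' *; arith.
    have Ec : c' = u :> nat.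
      by have := minu c' c'Q; have := cc' u uQ; rewrite /= in cb bc' *; arith.
    by move: e neus; rewrite Ec => ->.
  by have := edge_strad eq1 bB; rewrite /=; arith.
apply/setP => z; rewrite inE; apply/idP/idP; last exact: BQ.
(* A vertex of Q that is no corner lies strictly between neighbouring corners b and b'; both are in
   Q, and their link is a diagonal dividing Q. *)
move=> zQ; apply/negPn/negP => nzB.
have zs := ltn_ord z.
have z0 : 0 < z by rewrite lt0n; apply/eqP => E; move: nzB; rewrite /= E B0.
have [b [b' [bB b'B bz zb' bb']]] := @pred_gap (mem B) 0 s z B0 z0 s_B zs nzB.
have ebb' : edge N b b'.
  by apply: (sorted_adjacent ltn_B) => //; arith.
have abb' : (b, b') \in arcs N by apply: edge_arc => //; arith.
have bs : b < s by arith.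
have vb := val_vertex bs.
have bQ : vertex b \in Q by apply: BQ; rewrite vb.
have p1s : p1 < s by arith.
have p1Q : vertex p1 \in Q by apply: BQ; rewrite val_vertex.
have plQ : vertex pl \in Q by apply: BQ; rewrite val_vertex.
case: (vertex_cases (le_s b'B)) => [] [b's vb'].
  have b'Q : vertex b' \in Q by apply: BQ; rewrite vb'.
  have [|H|H] := nodiv1 _ _ bQ b'Q; first by rewrite -/(val (vertex b)) -/(val (vertex b')) vb vb'.
    by have := H z zQ; rewrite -/(val (vertex b)) -/(val (vertex b')) vb vb'; arith.
  have := H q0 q0Q; have := H _ plQ.
  rewrite -!/(val (vertex _)) vb vb' val_vertex //; have := strad abb' p1B; arith.
have [||H|H] := nodiv q0 (vertex b) q0Q bQ.
- rewrite -/(val (vertex b)) vb; have := strad abb' plB; arith.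
- apply/mem_dis; first by rewrite -/(val (vertex b)) vb; have := strad abb' plB; arith.
  by move: abb'; rewrite b's => abb'; right; rewrite -/(val (vertex b)) vb.
- have := H _ p1Q; have := strad abb' plB; rewrite -!/(val (vertex _)) vb val_vertex //; arith.
- have := H z zQ; rewrite -!/(val (vertex _)) vb; arith.
Qed.
(** The vertices are read in increasing order, s counting as 0. Two nodes could share a triangle
    only if one ends at s and the other starts at 0; the first lies beyond [pl] and the second
    before [p1]. *)
Lemma tri_inj : {in N &, injective tri}.
Proof.
pose vals (c : nat * nat * nat) :=
  if c.2 == s then [:: 0; c.1.1; c.1.2] else [:: c.1.1; c.1.2; c.2].
have vals_spec c : c \in N -> sorted ltn (vals c) /\
    forall n, (n \in vals c) = (n < s) && (vertex n \in tri c).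
  case: c => [[x w] y] H; have [_ xw wy ys] := conf_node_lt C H.
  have xs : x < s by arith.
  have ws : w < s by arith.
  have Sq := strad (node_arc H) qB.
  split; first by rewrite /vals /=; case: eqP => /= Ey; arith.
  move=> n; have [ns|ns] := ltnP n s; rewrite /= /vals /=; last first.
    by case: eqP => Ey; rewrite !inE; arith.
  rewrite !inE -!(inj_eq val_inj) /= !(@modn_small n) // (modn_small xs) (modn_small ws).
  case: eqP => [->|Ey]; first by rewrite modnn !inE orbC.
  by rewrite modn_small ?inE ?orbA //; arith.
move=> [[x w] y] [[x' w'] y'] H H' E.
have [srt mem] := vals_spec _ H; have [srt' mem'] := vals_spec _ H'.
have : vals (x, w, y) = vals (x', w', y').
  by apply: (irr_sorted_eq ltn_trans ltnn) => // n; rewrite mem mem' E.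
have [_ xw wy ys] := conf_node_lt C H; have [_ xw' wy' ys'] := conf_node_lt C H'.
have S t := @strad _ _ t (node_arc H); have S' t := @strad _ _ t (node_arc H').
have := S p1 p1B; have := S pl plB; have := S' p1 p1B; have := S' pl plB.
rewrite /vals /=; case: eqP => Ey; case: eqP => Ey' s1 s2 s3 s4 E'; case: E' => *; subst => //;
  exfalso; arith.
Qed.

Lemma in_dissection_dis : 3 < (size B).-1 -> in_dissection (size B).-1 (dis N).
Proof.
move=> r3; rewrite /in_dissection is_dissection_dis; apply/exists_inP.
exists (poly B); first exact: poly_piece.
have cP := card_poly.
have E : pieces (dis N) :\ poly B = [set Q in [seq tri c | c <- N]].
  apply/setP => Q; apply/setD1P/idP => [[QP /pieces_dis[E|[c cN ->]]]|].
  - by rewrite E eqxx in QP.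
  - by rewrite inE map_f.
  rewrite inE => /mapP[c cN ->]; split; last exact: tri_piece.
  by apply/eqP => E; move: r3; rewrite -cP -E card_tri.
rewrite cP eqxx E /=; apply/andP; split; last first.
  by apply/forall_inP => Q; rewrite inE => /mapP[c cN ->]; rewrite card_tri.
have uN : uniq N by have := conf_uniq C; rewrite /arcs => /map_uniq.
have -> : #|[set Q in [seq tri c | c <- N]]| = size N.
  rewrite -(size_map tri) cardsE; apply/card_uniqP.
  by rewrite map_inj_in_uniq //; apply: tri_inj.
have := conf_size C.
have -> : head 0 B = 0 by have := conf_range C B0; arith.
arith.
Qed.

End FromConf.

End Geometry.

(** * The forest of a dissection *)

Section Hull.

Variables (E : rel nat) (a c : nat).
(** The chord (a, c) is excepted because it passes over the whole interior; the points left
    uncovered are the vertices of the face just below it. *)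
Definition covered z : bool :=
  let I := iota a (c.+1 - a) in
  has (fun y => has (fun y' =>
    [&& y < z, z < y', E y y' & ~~ ((y == a) && (y' == c))]) I) I.

Lemma coveredP z : reflect
  (exists y y', [&& a <= y, y < z, z < y' & y' <= c] /\
                E y y' /\ ~~ ((y == a) && (y' == c)))
  (covered z).
Proof.
have memI t : (t \in iota a (c.+1 - a)) = (a <= t <= c) by rewrite mem_iota; lia.
apply: (iffP hasP) => [[y + /hasP[y' + /and4P[yz zy' Ey ne]]]|[y [y' [H [Ey ne]]]]].
  by rewrite !memI => Hy Hy'; exists y, y'; split=> //; lia.
exists y; rewrite ?memI; first lia.
by apply/hasP; exists y'; rewrite ?memI ?Ey ?ne; lia.
Qed.

Definition hull z : bool := [&& a <= z, z <= c & ~~ covered z].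

Lemma hull_range z : hull z -> a <= z <= c.
Proof. by case/and3P => -> ->. Qed.

Lemma hull_chord x y z : hull x -> hull y -> E x y -> ~~ ((x == a) && (y == c)) ->
  hull z -> z <= x \/ y <= z.
Proof.
move=> /hull_range Hx /hull_range Hy Exy ne /and3P[_ _ /coveredP nz].
case: (leqP z x) => xz; [by left|right]; rewrite leqNgt; apply/negP => zy.
by apply: nz; exists x, y; split=> //; lia.
Qed.

Hypothesis ac : a.+1 < c.
Hypothesis side_E : forall y, a <= y < c -> E y y.+1.
Hypothesis noncrossing_E : forall x y u v, a <= x -> x < u -> u < y -> y < v ->
  v <= c -> E x y -> E u v -> False.

Lemma hull_left : hull a.
Proof. by rewrite /hull leqnn /=; apply/andP; split; [lia|apply/coveredP => -[y [y' []]]; lia]. Qed.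

Lemma hull_right : hull c.
Proof. by rewrite /hull leqnn /=; apply/andP; split; [lia|apply/coveredP => -[y [y' []]]; lia]. Qed.

(** The successor is the far end of the longest chord from x other than (a, c). A chord over that
    end would start before x and cover x, start beyond x and cross, or start at x and be longer. *)
Lemma hull_next x : hull x -> x < c -> exists z,
  [/\ hull z, x < z, E x z, ~~ ((x == a) && (z == c)) &
      forall t, hull t -> t <= x \/ z <= t].
Proof.
move=> hx xc; have Hx := hull_range hx.
pose Q z := [&& x < z, z <= c, E x z & ~~ ((x == a) && (z == c))].
have exQ : exists z, Q z by exists x.+1; rewrite /Q side_E; lia.
have ubQ z : Q z -> z <= c by case/and4P.
case: (ex_maxnP exQ ubQ) => z /and4P[xz zc Exz ne] zmax.
have hz : hull z.
  rewrite /hull zc; apply/andP; split; first lia.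
  apply/coveredP => -[y [y' [H [Ey ne']]]].
  case: (ltngtP y x) => yx.
  - case/and3P: hx => _ _ /coveredP; apply; exists y, y'; split=> //; lia.
  - by apply: (@noncrossing_E x z y y') => //; lia.
  - have := zmax y'; rewrite /Q -yx Ey ne'; lia.
exists z; split=> // t; exact: hull_chord.
Qed.

End Hull.

Lemma inner_three (B : seq nat) s : sorted ltn B -> 4 < size B ->
  (forall t, t \in B -> t <= s) ->
  exists p1 q pl, [/\ p1 \in B, q \in B, pl \in B & [&& 0 < p1, p1 < q, q < pl & pl < s]].
Proof.
case: B => [|a [|b [|c [|d [|e B]]]]] //= /and5P[ab bc cd de _] _ H.
exists b, c, d; rewrite !inE !eqxx !orbT; split=> //.
have := H e; rewrite !inE eqxx !orbT => /(_ isT); lia.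
Qed.

Lemma uniq_leq_card (T : finType) (l : seq T) (Q : {set T}) :
  uniq l -> {subset l <= Q} -> size l <= #|Q|.
Proof.
by move=> ul sub; rewrite cardE; apply: uniq_leq_size => // x /sub; rewrite mem_enum.
Qed.

Section FromDissection.

Variable p : nat.
Local Notation s := p.+1.
Variables (D : {set {set 'I_s}}) (P : {set 'I_s}) (p1 q pl : nat).
Hypothesis disD : is_dissection D.
Hypothesis pieceP : P \in pieces D.
Hypothesis P0 : ord0 \in P.
Hypothesis other3 : forall Q, Q \in pieces D -> Q != P -> #|Q| = 3.

Definition corners : seq nat := rcons [seq val x | x <- enum P] s.
Local Notation B := corners.

Hypotheses (p1B : p1 \in B) (qB : q \in B) (plB : pl \in B).
Hypothesis ltB : [&& 0 < p1, p1 < q, q < pl & pl < s].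

Local Notation E x y := (chord p x y \in polygon_edges [set: 'I_s] :|: D).
Local Notation relE := (fun x y : nat => E x y).

Lemma sorted_corners : sorted ltn B.
Proof.
have := sorted_enum_set P; rewrite -sorted_map /corners.
have : all (gtn s) [seq val x | x <- enum P] by apply/allP => _ /mapP[x _ ->] /=.
elim: [seq val x | x <- enum P] => // h [|h' l] IH /=; first by rewrite !andbT.
by case/and3P => H1 H2 H3 /andP[-> H4]; apply: IH; rewrite //= H2.
Qed.

Lemma mem_corners (x : 'I_s) : (val x \in B) = (x \in P).
Proof.
rewrite mem_rcons inE mem_map ?mem_enum; last exact: val_inj.
by case: eqP (ltn_ord x) => //= ->; rewrite ltnn.
Qed.

Lemma corners_s : s \in B. Proof. by rewrite mem_rcons mem_head. Qed.

Lemma corners_0 : 0 \in B. Proof. by have := mem_corners ord0; rewrite P0. Qed.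

Lemma corners_le t : t \in B -> t <= s.
Proof.
by rewrite mem_rcons inE => /predU1P[->//|/mapP[x _ ->]]; apply/ltnW/ltn_ord.
Qed.

Definition gap b b' : Prop :=
  [/\ b \in B, b' \in B, b < b' & forall t, t \in B -> t <= b \/ b' <= t].

Lemma side_chord y : y < s -> E y y.+1.
Proof.
move=> ys; rewrite inE; apply/orP; left.
have vy := val_vertex ys.
case: (vertex_cases ys) => [] [ys' vy'].
  by apply/sideP; move: vy vy' => /= -> ->; [|left].
rewrite /chord setUC; apply/sideP; move: vy vy' => /= -> ->; first arith.
by right; arith.
Qed.

Lemma gap_chord b b' : gap b b' -> E b b'.
Proof.
case=> bB b'B bb' H; have b's := corners_le b'B.
move: pieceP; rewrite inE => /and3P[_ /subsetP sP _]; apply: sP.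
have bs : b < s by arith.
have vb := val_vertex bs.
have bP : vertex p b \in P by rewrite -mem_corners vb.
have HP (z : 'I_s) : z \in P -> z <= b \/ b' <= z by rewrite -mem_corners => /H.
case: (vertex_cases b's) => [] [b's' vb'].
  have b'P : vertex p b' \in P by rewrite -mem_corners vb'.
  apply/polygon_edgesP; first by move: vb vb' => /= -> ->.
  by split=> //; split=> //; left=> z /HP; move: vb vb' => /= -> ->.
have lt0b : 0 < b by have := H _ p1B; have := H _ plB; arith.
rewrite /chord b's' vertex_s setUC; apply/polygon_edgesP; first by move: vb => /= ->.
split=> //; split=> //; right=> z /HP; have := ltn_ord z; move: vb => /= ->; arith.
Qed.

(** Once s is identified with 0 the suspects are (0, s-1), (1, s) and the degenerate (0, s); each
    would put [q] strictly inside the gap. *)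
Lemma gap_not_side b b' x y : gap b b' -> b <= x -> x.+1 < y -> y <= b' ->
  chord p x y \notin polygon_edges [set: 'I_s].
Proof.
case=> bB b'B bb' H bx xy yb'; have b's := corners_le b'B.
have H1 := H _ p1B; have H2 := H _ plB; have H3 := H _ qB.
have xs : x < s by arith.
have ys : y <= s by arith.
have vx := val_vertex xs.
case: (vertex_cases ys) => [] [ys' vy].
  by apply/negP => /sideP; move: vx vy => /= -> ->; arith.
by rewrite /chord setUC; apply/negP => /sideP; move: vx vy => /= -> ->; arith.
Qed.

Lemma gap_chord_mem b b' x y : gap b b' -> b <= x -> x.+1 < y -> y <= b' ->
  E x y -> chord p x y \in D.
Proof.
by move=> g bx xy yb'; rewrite inE (negbTE (gap_not_side g bx xy yb')).
Qed.

Lemma noncrossing_D d e : d \in D -> e \in D -> ~~ crossing d e.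
Proof. by case/andP: disD => _ /forall_inP H dD eD; apply: (forall_inP (H d dD)). Qed.

Lemma gap_noncrossing b b' x y u v : gap b b' -> b <= x -> x < u -> u < y -> y < v ->
  v <= b' -> E x y -> E u v -> False.
Proof.
move=> g bx xu uy yv vb' Exy Euv.
have dxy : chord p x y \in D by apply: (gap_chord_mem g) => //; arith.
have duv : chord p u v \in D by apply: (gap_chord_mem g) => //; arith.
case: g => bB b'B bb' H; have b's := corners_le b'B.
have H1 := H _ p1B; have H2 := H _ plB.
have vs : v <= s by arith.
have [vx [vy vu]] : val (vertex p x) = x /\ val (vertex p y) = y /\ val (vertex p u) = u.
  by rewrite !val_vertex //; arith.
case: (vertex_cases vs) => [] [vs' vv].
  case/negP: (noncrossing_D dxy duv).
  apply/exists_inP; exists (vertex p x); first by rewrite set21.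
  apply/exists_inP; exists (vertex p y); first by rewrite set22.
  apply/exists_inP; exists (vertex p u); first by rewrite set21.
  apply/exists_inP; exists (vertex p v); first by rewrite set22.
  by move: vx vy vu vv => /= -> -> -> ->; arith.
case/negP: (noncrossing_D duv dxy).
apply/exists_inP; exists (vertex p v); first by rewrite set22.
apply/exists_inP; exists (vertex p u); first by rewrite set21.
apply/exists_inP; exists (vertex p x); first by rewrite set21.
apply/exists_inP; exists (vertex p y); first by rewrite set22.
by move: vx vy vu vv => /= -> -> -> ->; arith.
Qed.

Lemma diagonal_pair d : d \in D -> exists x y : 'I_s,
  [/\ x < y, d = [set x; y] & d \notin polygon_edges [set: 'I_s]].
Proof.
case/andP: disD => /subsetP sD _ /sD; rewrite inE => /andP[/cards2P[x [y [ne ->]]] H].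
case: (ltngtP x y) => [xy|yx|/val_inj e]; first by exists x, y.
  by exists y, x; split=> //; apply: setUC.
by rewrite e eqxx in ne.
Qed.

(* The piece on the inner side of the chord (a, c) consists of the vertices
   not cut off by another chord below it; being a triangle, it splits (a, c). *)
Lemma gap_split b b' a c : gap b b' -> b <= a -> a.+1 < c -> c <= b' -> E a c ->
  exists w, [/\ a < w, w < c, E a w & E w c].
Proof.
move=> g ba ac cb' Eac.
have [bB b'B bb' H] := g; have b's := corners_le b'B.
have H1 := H _ p1B; have H2 := H _ plB.
have sideE y : a <= y < c -> E y y.+1 by move=> Hy; apply: side_chord; arith.
have ncE x y u v : a <= x -> x < u -> u < y -> y < v -> v <= c -> E x y -> E u v -> False.
  by move=> ax xu uy yv vc; apply: (gap_noncrossing g); arith.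
pose h := hull relE a c.
have hr := @hull_range relE a c.
have ha : h a by apply: hull_left.
have hc : h c by apply: hull_right.
have hn := hull_next ac sideE ncE.
have hch := @hull_chord relE a c.
have [w [hw aw Eaw ne aw']] := hn a ha ltac:(arith).
have wc : w < c by have := hr w hw; arith.
exists w; split=> //.
have [w' [hw' ww' Eww' ne' ww'']] := hn w hw wc.
(* On the face, w follows a and w' follows w; as the face is a triangle, w' < c would give a fourth
   vertex. *)
suff <- : w' = c by [].
(* When c = s the face contains s, which is vertex 0: hence the extra clause. *)
pose Q : {set 'I_s} := [set v : 'I_s | h (val v) || (val v == 0) && (c == s)].
have memQ v : (v \in Q) = h (val v) || (val v == 0) && (c == s) by rewrite inE.
have cs : c <= s by arith.
have c0 : c = s -> 0 < a by arith.
have hQ t : h t -> vertex p t \in Q.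
  move=> ht; have Ht := hr t ht; have ts : t <= s by arith.
  rewrite inE; case: (vertex_cases ts) => [] [ts' ->]; first by rewrite ht.
  by rewrite eqxx; apply/orP; right; arith.
have va : val (vertex p a) = a by rewrite val_vertex //; arith.
have vw : val (vertex p w) = w by rewrite val_vertex //; arith.
have vc := vertex_cases cs.
have QD : Q \in pieces D.
  have Q2 : 2 < #|Q|.
    apply: (@uniq_leq_card _ [:: vertex p a; vertex p w; vertex p c]).
      apply: (@map_uniq _ _ val); rewrite /= !inE; move: va vw vc => /= -> ->.
      by move: (c %% s) => vc; arith.
    by move=> v; rewrite in_cons => /predU1P[->|]; rewrite ?hQ // in_cons => /predU1P[->|];
      rewrite ?hQ // in_cons => /predU1P[->|//]; rewrite hQ.
  rewrite inE Q2 /=; apply/andP; split.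
    apply/subsetP => e eQ; have [|x [y [xy Ee xQ yQ]]] := polygon_edge_pair _ eQ; first arith.
    have Exy : E x y = ([set x; y] \in polygon_edges [set: 'I_s] :|: D).
      by rewrite /chord !vertex_val.
    have Eys : x = 0 :> nat -> E y s = ([set x; y] \in polygon_edges [set: 'I_s] :|: D).
      move=> x0; have <- : ord0 = x by apply: val_inj.
      by rewrite /chord vertex_s vertex_val [[set y; _]]setUC.
    have ys := ltn_ord y.
    move: eQ; rewrite Ee => /polygon_edgesP-/(_ xy)[_ [_ Hxy]].
    have aQ := hQ a ha; have cQ := hQ c hc.
    have nxt : h x -> (forall z : 'I_s, z \in Q -> z <= x \/ y <= z) -> h y -> E x y.
      move=> hx Hc hy; have [|z [hz xz Exz nez xz']] := hn x hx; first by have := hr y hy; arith.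
      suff -> : y = z :> nat by [].
      have Hy := xz' y hy; have Hz := hr z hz; have Hy' := hr y hy.
      have zs : z < s by arith.
      have := Hc (vertex p z) (hQ z hz); rewrite -/(val (vertex p z)) (val_vertex zs); arith.
    move: xQ yQ; rewrite !memQ.
    case: (eqVneq c s) => Ecs; last first.
      have vc' : val (vertex p c) = c by case: vc => [] [] *; arith.
      rewrite !andbF !orbF => hx hy; rewrite -Exy; case: Hxy => Hxy; first exact: nxt.
      have := Hxy _ aQ; have := Hxy _ cQ; rewrite -!/(val (vertex p _)) va vc'.
      have := hr x hx; have := hr y hy => Hy Hx Hc Ha.
      have -> : x = a :> nat by arith.
      by have -> : y = c :> nat by arith.
    have Q0 : vertex p s \in Q by move: cQ; rewrite Ecs.
    have a0 := c0 Ecs.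
    rewrite !andbT => /orP[hx|/eqP /= x0] /orP[hy|/eqP /= y0]; try arith.
      rewrite -Exy; case: Hxy => Hxy; first exact: nxt.
      have := Hxy _ Q0; rewrite vertex_s /=; have := hr x hx; arith.
    rewrite -(Eys x0); case: Hxy => Hxy.
      have := Hxy _ aQ; rewrite -!/(val (vertex p _)) va; have := hr y hy => Hy Ha.
      have -> : y = a :> nat by arith.
      by move: Eac; rewrite Ecs.
    have [|z [hz yz Eyz nez yz']] := hn y hy; first arith.
    have Hz := hr z hz; suff zs : z = s by move: Eyz; rewrite zs.
    suff : ~ z < s by arith.
    move=> zs; have := Hxy _ (hQ z hz).
    by rewrite -!/(val (vertex p _)) (val_vertex zs); arith.
  apply/forall_inP => d dD; apply/implyP => /subsetP dQ.
  have [x [y [xy Ed nd]]] := diagonal_pair dD.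
  have ys := ltn_ord y; have xs := ltn_ord x.
  have xQ : x \in Q by apply: dQ; rewrite Ed set21.
  have yQ : y \in Q by apply: dQ; rewrite Ed set22.
  rewrite Ed; apply/polygon_edgesP => //; split=> //; split=> //.
  have Exy : E x y by rewrite /chord !vertex_val -Ed inE dD orbT.
  move: xQ yQ; rewrite !memQ.
  case: (eqVneq c s) => Ecs; last first.
    rewrite !andbF !orbF => hx hy.
    case: (boolP ((val x == a) && (val y == c))) => nac.
      right=> z; rewrite inE (negbTE Ecs) andbF orbF => /hr; move: nac => /=; arith.
    left=> z; rewrite inE (negbTE Ecs) andbF orbF => hz.
    exact: hch hx hy Exy nac hz.
  have a0 := c0 Ecs.
  rewrite !andbT => /orP[hx|/eqP /= x0] /orP[hy|/eqP /= y0]; try arith.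
    left=> z; rewrite inE => /orP[hz|/andP[/eqP /= z0 _]]; last arith.
    by apply: hch hx hy Exy _ hz; rewrite /=; arith.
  have Eys : E y c.
    have -> : c = s by [].
    rewrite /chord vertex_s vertex_val [[set y; _]]setUC (_ : ord0 = x); last exact: val_inj.
    by rewrite -Ed inE dD orbT.
  case: (eqVneq (val y) a) => [ya|ya]; [left|right] => z; rewrite inE => /orP[hz|/andP[/eqP /= z0 _]].
  - by right; have := hr z hz; rewrite /= in ya; arith.
  - by left; arith.
  - have nyc : ~~ ((val y == a) && (c == c)) by rewrite (negbTE ya).
    by have := hch _ _ _ hy hc Eys nyc hz; have := ltn_ord z; rewrite /=; arith.
  - arith.
(* Apart from 0, Q lies within one gap, which cannot contain both [p1] and [pl] since [q] separates
   them. *)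
have QP : Q != P.
  apply/eqP => EQ.
  have p1Q : vertex p p1 \in Q by rewrite EQ -mem_corners val_vertex //; arith.
  have plQ : vertex p pl \in Q by rewrite EQ -mem_corners val_vertex //; arith.
  move: p1Q plQ; rewrite !inE !val_vertex; try arith.
  move=> /orP[/hr p1Q|p1Q] /orP[/hr plQ|plQ]; try arith.
  have : ord0 \in Q by rewrite EQ.
  rewrite inE => /orP[/hr /=|/= /eqP]; arith.
have c3 := other3 QD QP.
apply/eqP; rewrite eqn_leq; apply/andP; split; first by have := hr w' hw'; arith.
rewrite leqNgt; apply/negP => w'c.
have : size [:: vertex p a; vertex p w; vertex p w'; vertex p c] <= #|Q|.
  apply: uniq_leq_card.
    have vw' : val (vertex p w') = w' by rewrite val_vertex //; arith.
    apply: (@map_uniq _ _ val); rewrite /= !inE; move: va vw vw' vc => /= -> -> ->.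
    by move: (c %% s) => vc; arith.
  by move=> v; rewrite in_cons => /predU1P[->|]; rewrite ?hQ // in_cons => /predU1P[->|];
    rewrite ?hQ // in_cons => /predU1P[->|]; rewrite ?hQ // in_cons => /predU1P[->|//]; rewrite hQ.
by rewrite c3.
Qed.

(** Recursion on the length of the chord. The part right of the split point is built first, as
    [conf] grows leftwards. A chord over w can only be (a, c), or it would cross (a, w) or (w,
    c). *)
Lemma conf_below_chord b b' a c l N : gap b b' -> b <= a -> a < c -> c <= b' -> E a c ->
  conf s (c :: l) N -> exists N', conf s [:: a, c & l] (N' ++ N) /\
    forall x y, (x, y) \in arcs N' <-> [&& a <= x, x.+1 < y & y <= c] /\ E x y.
Proof.
move=> g; have [m] := ubnP (c - a); elim: m a c l N => // m IH a c l N lt_m ba ac cb' Eac C.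
have [Ec|ltac] : c = a.+1 \/ a.+1 < c by arith.
  subst c; exists [::]; split=> [|x y]; first exact: conf_leaf.
  by split=> // -[]; arith.
have [w [aw wc Eaw Ewc]] := gap_split g ba ltac cb' Eac.
have [||||N1 [C1 H1]] := IH w c l N _ _ _ _ Ewc C; try arith.
have [||||N2 [C2 H2]] := IH a w (c :: l) (N1 ++ N) _ _ _ _ Eaw C1; try arith.
exists ((a, w, c) :: N2 ++ N1); split.
  by rewrite /= -catA; apply: conf_node.
move=> x y; rewrite arcs_cons /arcs map_cat inE mem_cat -/(arcs N1) -/(arcs N2); split.
  by case/or3P => [/eqP[-> ->]|/H2[]|/H1[]] => [|? ?|? ?]; split=> //; arith.
move=> [Hxy Exy].
have [yw|wy] := leqP y w; first by apply/or3P; apply: Or32; apply/H2; split=> //; arith.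
have [wx|xw] := leqP w x; first by apply/or3P; apply: Or33; apply/H1; split=> //; arith.
have xa : x = a.
  apply/eqP; rewrite eqn_leq; apply/andP; split; last arith.
  rewrite leqNgt; apply/negP => ax.
  by apply: (gap_noncrossing g ba ax xw wy _ Eaw Exy); arith.
have yc : y = c.
  apply/eqP; rewrite eqn_leq; apply/andP; split; first arith.
  rewrite leqNgt; apply/negP => yc.
  by apply: (gap_noncrossing g _ xw wy yc cb' Exy Ewc); arith.
by rewrite xa yc eqxx.
Qed.

(** The gaps are filled from the right; [pre] records that consecutive entries of [h :: l] are
    neighbouring corners. *)
Lemma conf_suffix pre h l : B = pre ++ h :: l -> exists N, conf s (h :: l) N /\
  forall x y, (x, y) \in arcs N <-> [/\ h <= x, x.+1 < y, E x y &
    exists b b', [/\ gap b b', b <= x & y <= b']].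
Proof.
elim: l h pre => [|h' l IH] h pre EB.
  have -> : h = s.
    have : last 0 B = s by rewrite /corners last_rcons.
    by rewrite EB last_cat.
  exists [::]; split=> [|x y]; first exact: conf_nil.
  split=> // -[hx xy _ [b [b' [[_ b'B _ _] bx yb']]]].
  by have := corners_le b'B; arith.
have [|N [C H]] := IH h' (rcons pre h); first by rewrite cat_rcons.
have g : gap h h'.
  have := sorted_corners; rewrite (sorted_pairwise ltn_trans) /gap EB pairwise_cat /=.
  case/and3P => /allrelP H1 _ /and3P[/andP[hh' _] /allP H2 _].
  rewrite !mem_cat !inE !eqxx !orbT; split=> // t; rewrite mem_cat !inE.
  case/or4P => [tp|/eqP->|/eqP->|/H2 /=]; try arith.
  by have := H1 t h tp (mem_head _ _); rewrite /=; arith.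
have [hB h'B hh' gH] := g.
have [N' [C' H']] := conf_below_chord g (leqnn _) hh' (leqnn _) (gap_chord g) C.
exists (N' ++ N); split=> // x y; rewrite /arcs map_cat mem_cat -/(arcs N) -/(arcs N'); split.
  case/orP => [/H'[Hxy Exy]|/H[h'x xy Exy ex]]; split=> //; try arith.
  by exists h, h'; split=> //; arith.
case=> hx xy Exy [b [b' [g' bx yb']]]; apply/orP.
have [h'x|xh'] := leqP h' x; [right; apply/H; split=> //|left; apply/H'; split=> //].
  by exists b, b'.
have [bB b'B bb' gH'] := g'.
have := gH' h hB; have := gH' h' h'B; have := gH b bB; have := gH b' b'B; arith.
Qed.

(** What remains is that each diagonal lies within one gap. If both ends are in P it is an edge of
    P, hence the link of a gap; otherwise noncrossing with the link over an end outside P confines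
    it. *)
Lemma conf_of_dissection : exists N, conf s B N /\ dis p N = D.
Proof.
have [h [l EB]] : exists h l, B = h :: l.
  by case: B p1B => // h l _; exists h, l.
have [N [C H]] := @conf_suffix [::] h l EB.
have Eh : h = 0.
  have := sorted_corners; have := corners_0; rewrite EB inE => /predU1P[//|l0] /=.
  by move/(order_path_min ltn_trans)/allP/(_ _ l0) => /=; arith.
exists N; rewrite EB; split=> //.
have toDis x y b b' : x.+1 < y -> E x y -> gap b b' -> b <= x -> y <= b' -> chord p x y \in dis p N.
  move=> xy Exy g bx yb'; apply/disP; exists x, y; split=> //; apply/H; split=> //; first by rewrite Eh.
  by exists b, b'.
apply/setP => d; apply/idP/idP.
  case/disP => x [y [/H[_ xy Exy [b [b' [g bx yb']]]] ->]].
  exact: (gap_chord_mem g).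
move=> dD; have [u [v [uv Ed nd]]] := diagonal_pair dD.
have us := ltn_ord u; have vs := ltn_ord v.
have dE : d \in polygon_edges [set: 'I_s] :|: D by rewrite inE dD orbT.
have Euv : chord p u v = d by rewrite /chord !vertex_val.
have n1 : v <> u.+1 :> nat by move=> E1; case/negP: nd; rewrite Ed; apply/sideP => //; left.
have n2 : u = 0 :> nat -> v.+1 <> s.
  by move=> u0 E1; case/negP: nd; rewrite Ed; apply/sideP => //; right; arith.
have Evs : u = 0 :> nat -> chord p v s = d.
  move=> u0; rewrite /chord vertex_s vertex_val setUC Ed; congr [set _; _].
  exact: val_inj.
have sided (x y : 'I_s) : x < y -> d = [set x; y] -> x.+1 < y /\ (x = 0 :> nat -> y.+1 <> s).
  move=> xy; rewrite Ed => /set2_inj[] [Ex Ey]; subst x y; last arith.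
  by split=> //; arith.
have outside (z z' : 'I_s) : z \notin P -> d = [set z; z'] -> d \in dis p N.
  move=> zP Ez; have zs := ltn_ord z; have z's := ltn_ord z'.
  have ne : z <> z' :> nat.
    by move=> /val_inj E1; case: (set2_inj (etrans (esym Ed) Ez)) => [] [Eu Ev];
      move: uv; rewrite Eu Ev E1 ltnn.
  have z0 : 0 < z.
    by rewrite lt0n; apply/eqP => E1; case/negP: zP; rewrite (_ : z = ord0) //; apply: val_inj.
  have zB : ~~ (mem B) (val z) by rewrite /= mem_corners.
  have [b [b' [bB b'B bz zb' bb']]] := @pred_gap (mem B) 0 s z corners_0 z0 corners_s zs zB.
  have g : gap b b' by split=> //; arith.
  have b's := corners_le b'B.
  have dbb' : chord p b b' \in D.
    by apply: (gap_chord_mem g) => //; [arith|exact: gap_chord].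
  have bs : b < s by arith.
  have vb := val_vertex bs.
  have cross (f f' : {set 'I_s}) (i j m n : 'I_s) : f \in D -> f' \in D -> i \in f -> j \in f ->
      m \in f' -> n \in f' -> i < m -> m < j -> j < n -> False.
    move=> fD f'D iF jF mF nF im mj jn; case/negP: (noncrossing_D fD f'D).
    apply/exists_inP; exists i => //; apply/exists_inP; exists j => //.
    by apply/exists_inP; exists m => //; apply/exists_inP; exists n => //; rewrite im mj.
  have zd : z \in d by rewrite Ez set21.
  have z'd : z' \in d by rewrite Ez set22.
  have bd : vertex p b \in chord p b b' by rewrite set21.
  have b'd : vertex p b' \in chord p b b' by rewrite set22.
  have Ezz : chord p z z' = d by rewrite /chord !vertex_val.
  have Ezz' : chord p z' z = d by rewrite /chord !vertex_val setUC.
  (* A second end z' outside [b, b'] makes the diagonal cross the link (b, b'), except when z' = 0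
     and b' = s, where z' stands for s. *)
  have [z'b|bz'] := ltnP z' b.
    have [z'0|z'0] := posnP z'.
      have [b's'|b's'] := ltnP b' s; last first.
        have Ezs : chord p z s = d.
          by rewrite /chord vertex_s vertex_val Ez; congr [set _; _]; apply: val_inj.
        have z'z : z' < z by arith.
        have [|_ /(_ z'0) nzs] := sided z' z z'z; first by rewrite Ez setUC.
        by rewrite -Ezs in dE *; apply: (toDis _ _ b b') => //; arith.
      exfalso; have vb' := val_vertex b's'.
      apply: (cross _ _ z' z (vertex p b) (vertex p b') dD dbb') => //;
        by move: vb vb' => /= ? ?; arith.
    exfalso; case: (vertex_cases b's) => [] [b's' vb'].
      apply: (cross _ _ z' z (vertex p b) (vertex p b') dD dbb') => //;
        by move: vb vb' => /= ? ?; arith.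
    apply: (cross _ _ (vertex p b') (vertex p b) z' z dbb' dD) => //;
      by move: vb vb' => /= ? ?; arith.
  have [b'z'|z'b'] := ltnP b' z'.
    have b's' : b' < s by arith.
    exfalso; have vb' := val_vertex b's'.
    apply: (cross _ _ (vertex p b) (vertex p b') z z' dbb' dD) => //;
      by move: vb vb' => /= ? ?; arith.
  have [zz'|zz'] : z < z' \/ z' < z by arith.
    have [//|l1 _] := sided z z' zz'.
    by rewrite -Ezz in dE *; apply: (toDis _ _ b b') => //; arith.
  have [|l1 _] := sided z' z zz'; first by rewrite Ez setUC.
  by rewrite -Ezz' in dE *; apply: (toDis _ _ b b') => //; arith.
case: (boolP (u \in P)) => uP; last exact: (outside u v).
case: (boolP (v \in P)) => vP; last by apply: (outside v u); rewrite // Ed setUC.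
have : d \in polygon_edges P.
  move: pieceP; rewrite inE => /and3P[_ _ /forall_inP/(_ d dD)/implyP]; apply.
  by rewrite Ed; apply/subsetP => z; rewrite !inE => /orP[] /eqP->.
rewrite {1}Ed => /polygon_edgesP-/(_ uv)[_ [_ Huv]].
have HB t : t \in B -> t = s \/ exists2 z : 'I_s, z \in P & val z = t.
  move=> tB; have := corners_le tB; rewrite leq_eqVlt => /predU1P[|ts]; first by left.
  by right; exists (vertex p t); rewrite ?val_vertex // -mem_corners val_vertex.
case: Huv => Huv.
  have g : gap u v.
    rewrite /gap -!/(val _) !mem_corners; split=> // t /HB[->|[z /Huv + <-]] /=; arith.
  by rewrite -Euv in dE *; apply: (toDis _ _ u v) => //; arith.
have u0 : u = 0 :> nat by have := Huv _ P0; rewrite /=; arith.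
have g : gap v s.
  rewrite /gap -!/(val _) mem_corners; split=> //; first exact: corners_s.
  by move=> t /HB[->|[z /Huv + <-]] /=; arith.
by rewrite -(Evs u0) in dE *; apply: (toDis _ _ v s) => //; have := n2 u0; arith.
Qed.

End FromDissection.

(** * Counting *)

Section Counting.

Variable p : nat.
Local Notation s := p.+1.

Lemma conf_inner B N : conf s B N -> 4 < size B -> exists p1 q pl,
  [/\ p1 \in B, q \in B, pl \in B & [/\ 0 < p1, p1 < q, q < pl & pl < s]].
Proof.
move=> C B4; have [srt _] := conf_sorted C.
have [|p1 [q [pl [p1B qB plB /and4P[]]]]] := inner_three srt B4 (s := s).
  by move=> t /(conf_range C)/andP[].
by exists p1, q, pl; split.
Qed.

Lemma conf_rooted r B N : 3 < r -> conf s B N -> size B = r.+1 -> 0 \in B ->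
  [/\ in_dissection r (dis p N), poly p B \in pieces (dis p N), #|poly p B| = r &
      ord0 \in poly p B].
Proof.
move=> r3 C sB B0.
have [|p1 [q [pl [p1B qB plB [? ? ? ?]]]]] := conf_inner C; first by rewrite sB.
split.
- have -> : r = (size B).-1 by rewrite sB.
  by apply: (@in_dissection_dis _ B N C p1 q pl); rewrite ?sB.
- exact: (@poly_piece _ B N C p1 q pl).
- by rewrite (card_poly C) sB.
- by rewrite inE.
Qed.

(** Folding is undone by the common corners: {0, y} comes from (0, y) only if y <= [p1], and from
    (y, s) only if [pl] <= y. *)
Lemma sub_arcs B N N' : 4 < size B -> conf s B N -> conf s B N' ->
  dis p N = dis p N' -> {subset arcs N <= arcs N'}.
Proof.
move=> B4 C C' E [x y] H.
have [p1 [q [pl [p1B qB plB [lt1 lt2 lt3 lt4]]]]] := conf_inner C B4.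
have [_ xy ys] := conf_arc_lt C H.
have strad M u v t : conf s B M -> (u, v) \in arcs M -> t \in B -> ~~ (u < t < v).
  by move=> CM Huv tB; apply/negP; apply: conf_straddle CM tB Huv.
have S1 := strad _ _ _ _ C H p1B; have S2 := strad _ _ _ _ C H plB.
have xs : x < s by lia.
have vx := val_vertex xs.
have : chord p x y \in dis p N' by rewrite -E; apply/disP; exists x, y.
have memN' := mem_dis C'.
case: (vertex_cases ys) => [] [ys' vy].
  case/memN'; move: vx vy => /= -> -> //.
    lia.
  by case=> x0 H'; have := strad _ _ _ _ C' H' plB; lia.
rewrite /chord setUC; case/memN'; move: vx vy => /= -> ->; first lia.
  by move=> H'; have := strad _ _ _ _ C' H' p1B; lia.
by case=> _; rewrite -ys'.
Qed.

(** The corners come first, from the unique r-gon; only with a common list B can the arcs be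
    compared. *)
Lemma conf_dis_inj r B B' N N' : 3 < r -> conf s B N -> conf s B' N' ->
  size B = r.+1 -> size B' = r.+1 -> 0 \in B -> 0 \in B' -> dis p N = dis p N' ->
  B = B' /\ N = N'.
Proof.
move=> r3 C C' sB sB' B0 B0' E.
have [D1 P1 c1 _] := conf_rooted r3 C sB B0.
have [D2 P2 c2 _] := conf_rooted r3 C' sB' B0'.
have EP : poly p B = poly p B'.
  by apply: (big_piece_uniq (r := r) (D := dis p N)) => //; [lia|rewrite E].
have [srt _] := conf_sorted C; have [srt' _] := conf_sorted C'.
have EB : B = B'.
  apply: (irr_sorted_eq ltn_trans ltnn srt srt') => t.
  have [ts|] := ltnP t s.
    have := congr1 (fun P : {set 'I_s} => vertex p t \in P) EP.
    by rewrite /= !inE val_vertex.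
  rewrite leq_eqVlt => /predU1P[<-|st].
    by rewrite (conf_head_last C).2 (conf_head_last C').2.
  by apply/idP/idP => [/(conf_range C)|/(conf_range C')]; lia.
split=> //; subst B'; apply: (conf_inj C C') => c; apply/idP/idP.
  by apply: (sub_arcs _ C C' E); rewrite sB.
by apply: (sub_arcs _ C' C (esym E)); rewrite sB.
Qed.

Lemma rooted_conf r D : 3 < r -> D \in rooted_dissections p r ->
  exists B N, [/\ conf s B N, size B = r.+1, 0 \in B & dis p N = D].
Proof.
move=> r3; rewrite inE => /andP[DD /exists_inP[P PD /andP[/eqP cP P0]]].
have other3 Q : Q \in pieces D -> Q != P -> #|Q| = 3.
  move=> QD QP; have := DD => /andP[_ /exists_inP[M MD /and3P[/eqP cM _ /forall_inP H]]].
  have EM : P = M by apply: (big_piece_uniq (r := r) (D := D)) => //; lia.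
  by apply/eqP/H/setD1P; rewrite -EM.
have sB : size (corners P) = r.+1 by rewrite size_rcons size_map -cardE cP.
have [|t /corners_le //|p1 [q [pl [p1B qB plB lt]]]] := inner_three (sorted_corners P) (s := s).
  by rewrite sB.
have [N [C E]] := conf_of_dissection (proj1 (andP DD)) PD P0 other3 p1B qB plB lt.
exists (corners P), N; split=> //; exact: corners_0.
Qed.

Lemma card_rooted_dissections r : 2 < r -> r < s ->
  #|rooted_dissections p r.+1| + 'C(s - r.+1 + (s - r.+1) + r, s - r.+1 + r.+1)
    = 'C(s - r.+1 + (s - r.+1) + r, s - r.+1 + r).
Proof.
move=> r2 rs; have r3 : 3 < r.+1 by []; have [|L [uL mL <-]] := @ex_confs s r.+1 (s - r.+1); first lia.
congr (_ + _).
(* With as many nodes as the polygon has triangles, [conf_size] forces the forest to start at 0. *)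
have zero_mem B N : conf s B N -> size B = r.+2 -> size N = s - r.+1 -> 0 \in B.
  move=> C sB sN; have := conf_size C; rewrite sB sN /= => H.
  have h0 : head 0 B = 0 by lia.
  by have := (conf_head_last C).1; rewrite h0.
pose f (c : seq nat * seq (nat * nat * nat)) := dis p c.2.
rewrite -(size_map f); have /card_uniqP <- : uniq (map f L).
  rewrite map_inj_in_uniq // => -[B N] [B' N'] /mL[/= C sB sN] /mL[/= C' sB' sN'] E.
  have B0 := zero_mem _ _ C sB sN; have B0' := zero_mem _ _ C' sB' sN'.
  by have [-> ->] := conf_dis_inj r3 C C' sB sB' B0 B0' E.
apply: eq_card => D; apply/idP/mapP.
  move/(rooted_conf r3) => [B [N [C sB B0 <-]]]; exists (B, N) => //; apply/mL; split=> //=.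
  have := conf_size C; have := conf_range C B0; rewrite sB /=; lia.
case=> [[B N] /mL[/= C sB sN] ->]; have B0 := zero_mem _ _ C sB sN.
have [D1 P1 c1 P0] := conf_rooted (r := r.+1) r3 C sB B0.
by rewrite inE D1; apply/exists_inP; exists (poly p B); rewrite // c1 eqxx.
Qed.

Lemma rooted_dissections_large r : s < r -> rooted_dissections p r = set0.
Proof.
move=> sr; apply/setP => D; rewrite !inE; apply/negP.
case/andP => _ /exists_inP[P _ /andP[/eqP cP _]].
by have := max_card (mem P); rewrite card_ord cP; lia.
Qed.

End Counting.

Lemma eq_card_bijective (S T : finType) : #|S| = #|T| -> exists f : S -> T, bijective f.
Proof.
move=> E; exists (fun x => enum_val (cast_ord E (enum_rank x))).
exists (fun y => enum_val (cast_ord (esym E) (enum_rank y))) => [x|y].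
  by rewrite enum_valK cast_ordK enum_rankK.
by rewrite enum_valK cast_ordKV enum_rankK.
Qed.

Theorem theorem6p3 (k n : nat) (hk : 1 <= k) (hn : 1 <= n) :
  exists f : {a : n.-tuple 'I_n | descending a && strictly_naples k a} ->
             {C : {set {set {set 'I_(n + k + 1)}} * {set 'I_(n + k + 1)}}
                | C \in marked_dissection_classes (n + k + 1) (2 * k + 2)},
    bijective f.
Proof.
apply: eq_card_bijective; rewrite !card_sig card_descending_strictly_naples //.
rewrite addn1; set A := RHS.
have -> : A = #|marked_dissection_classes (n + k).+1 (2 * k + 2)| by apply: eq_card.
rewrite card_marked_dissection_classes; last lia.
(* For n <= k both sides vanish: 2k+2 exceeds n+k+1, and n+k exceeds 2n-1. *)
have [kn|nk] := ltnP k n; last first.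
  by rewrite rooted_dissections_large ?cards0 ?bin_small //; lia.
have k3 : 2 < 2 * k + 1 by lia.
have ks : 2 * k + 1 < (n + k).+1 by lia.
have := card_rooted_dissections k3 ks.
have -> : (2 * k + 1).+1 = 2 * k + 2 by lia.
have -> : (n + k).+1 - (2 * k + 2) + ((n + k).+1 - (2 * k + 2)) + (2 * k + 1) = (n + n).-1 by lia.
have -> : (n + k).+1 - (2 * k + 2) + (2 * k + 2) = (n + k).+1 by lia.
have -> : (n + k).+1 - (2 * k + 2) + (2 * k + 1) = n + k by lia.
by move=> <-; rewrite addnK.
Qed.
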